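(* Let $[a,b]\subset\mathbb{R}$ be a compact interval, let $m\geq1$, $r\geq2$, $n\geq0$ be integers, let $0<\alpha\leq1$, and let $\varepsilon_0>0$. For each $\varepsilon\in[0,\varepsilon_0)$ let $A_{r-j}(\cdot,\varepsilon)\in(C^{n,\alpha})^{m\times m}$ for $j=1,\dots,r$, and let $B(\varepsilon):(C^{n+r,\alpha})^{m}\to\mathbb{C}^{rm}$ be a continuous linear operator. Put $L(\varepsilon)y:=y^{(r)}+\sum_{j=1}^{r}A_{r-j}(\cdot,\varepsilon)y^{(r-j)}$ and consider the boundary-value problem $L(\varepsilon)y(\cdot,\varepsilon)=f(\cdot,\varepsilon)$ on $[a,b]$, $B(\varepsilon)y(\cdot,\varepsilon)=c(\varepsilon)$, with $f(\cdot,\varepsilon)\in(C^{n,\alpha})^{m}$, $c(\varepsilon)\in\mathbb{C}^{rm}$ and unknown $y(\cdot,\varepsilon)\in(C^{n+r,\alpha})^{m}$. Assume: (0) the problem $L(0)y=0$, $B(0)y=0$ has only the trivial solution in $(C^{n+r,\alpha})^{m}$; (I) $A_{r-j}(\cdot,\varepsilon)\to A_{r-j}(\cdot,0)$ in $(C^{n,\alpha})^{m\times m}$ as $\varepsilon\to0+$ for each $j\in\{1,\dots,r\}$; (II) $B(\varepsilon)y\to B(0)y$ in $\mathbb{C}^{rm}$ as $\varepsilon\to0+$ for every $y\in(C^{n+r,\alpha})^{m}$. Let $\varepsilon_1\in(0,\varepsilon_0)$ be such that for every $\varepsilon\in[0,\varepsilon_1)$ and all right-hand sides $f(\cdot,\varepsilon)$,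 $c(\varepsilon)$ the problem has a unique solution $y(\cdot,\varepsilon)\in(C^{n+r,\alpha})^{m}$ (such $\varepsilon_1$ exists under these assumptions). Then there exist positive numbers $\varepsilon_2<\varepsilon_1$, $\varkappa_1$, $\varkappa_2$ such that for every choice of $f(\cdot,\varepsilon)$, $c(\varepsilon)$ ($\varepsilon\in[0,\varepsilon_1)$), with $y(\cdot,\varepsilon)$ the corresponding unique solutions, $$\varkappa_1\,d_{n,\alpha}(\varepsilon)\leq\|y(\cdot,0)-y(\cdot,\varepsilon)\|_{n+r,\alpha}\leq\varkappa_2\,d_{n,\alpha}(\varepsilon)\quad\text{for every }\varepsilon\in(0,\varepsilon_2),$$ where $d_{n,\alpha}(\varepsilon):=\|L(\varepsilon)y(\cdot,0)-f(\cdot,\varepsilon)\|_{n,\alpha}+|B(\varepsilon)y(\cdot,0)-c(\varepsilon)|$. The numbers $\varepsilon_2,\varkappa_1,\varkappa_2$ do not depend on the functions $y(\cdot,0)$ and $y(\cdot,\varepsilon)$.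
   Context: $C^{n,\alpha}$ denotes the complex Hölder space of all $n$ times continuously differentiable functions $x:[a,b]\to\mathbb{C}$ with $\|x\|'_{n,\alpha}:=\sup_{a\leq t_1<t_2\leq b}|x^{(n)}(t_2)-x^{(n)}(t_1)|/|t_2-t_1|^{\alpha}<\infty$, normed by $\|x\|_{n,\alpha}:=\sum_{j=0}^{n}\max_{[a,b]}|x^{(j)}|+\|x\|'_{n,\alpha}$. $(C^{n,\alpha})^{m}$ and $(C^{n,\alpha})^{m\times m}$ are the spaces of $m$-column vector-valued and $m\times m$ matrix-valued functions with entries in $C^{n,\alpha}$, normed by the sum of the entries' norms (also denoted $\|\cdot\|_{n,\alpha}$). $|\cdot|$ is a norm on $\mathbb{C}^{rm}$. *)

(* Defs.v *)
From Stdlib Require Import Reals List ClassicalEpsilon.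
From Coquelicot Require Import Coquelicot.
Open Scope R_scope.

Definition sumR (l : list nat) (F : nat -> R) : R :=
  fold_right (fun i acc => F i + acc) 0 l.
Definition sumC (l : list nat) (F : nat -> C) : C :=
  fold_right (fun i acc => Cplus (F i) acc) (RtoC 0) l.

Definition is_deriv_in (a b : R) (f g : R -> C) : Prop :=
  forall t, a <= t <= b ->
    forall eps, 0 < eps -> exists delta, 0 < delta /\
      forall s, a <= s <= b -> s <> t -> Rabs (s - t) < delta ->
        Cmod (Cminus (Cdiv (Cminus (f s) (f t)) (RtoC (s - t))) (g t)) < eps.

Definition cont_on (a b : R) (f : R -> C) : Prop :=
  forall t, a <= t <= b ->
    forall eps, 0 < eps -> exists delta, 0 < delta /\
      forall s, a <= s <= b -> Rabs (s - t) < delta -> Cmod (Cminus (f s) (f t)) < eps.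

Lemma inh_fun : inhabited (R -> C).
Proof. exact (inhabits (fun _ => RtoC 0)). Qed.

(** A (chosen) derivative within [a,b]; meaningful when one exists. *)
Definition der1 (a b : R) (f : R -> C) : R -> C :=
  epsilon inh_fun (fun g => is_deriv_in a b f g).

Fixpoint derw (a b : R) (f : R -> C) (j : nat) : R -> C :=
  match j with
  | O => f
  | S j' => der1 a b (derw a b f j')
  end.

Definition in_Cna (a b : R) (n : nat) (alpha : R) (x : R -> C) : Prop :=
  (forall j, (j < n)%nat -> is_deriv_in a b (derw a b x j) (derw a b x (S j))) /\
  cont_on a b (derw a b x n) /\
  exists M, forall t1 t2, a <= t1 < t2 -> t2 <= b ->
    Cmod (Cminus (derw a b x n t2) (derw a b x n t1)) <= M * Rpower (t2 - t1) alpha.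

Definition supabs (a b : R) (g : R -> C) : R :=
  real (Lub_Rbar (fun v => exists t, a <= t <= b /\ v = Cmod (g t))).

Definition holsemi (a b alpha : R) (g : R -> C) : R :=
  real (Lub_Rbar (fun v => exists t1 t2, a <= t1 < t2 /\ t2 <= b /\
          v = Cmod (Cminus (g t2) (g t1)) / Rpower (t2 - t1) alpha)).

Definition hnorm (a b : R) (n : nat) (alpha : R) (x : R -> C) : R :=
  sumR (seq 0 (S n)) (fun j => supabs a b (derw a b x j))
  + holsemi a b alpha (derw a b x n).

(** m-column vector functions (components i < m) and m x m matrix functions. *)
Definition vfun := nat -> R -> C.
Definition mfun := nat -> nat -> R -> C.

Definition vin_Cna (a b : R) (m n : nat) (alpha : R) (y : vfun) : Prop :=
  forall i, (i < m)%nat -> in_Cna a b n alpha (y i).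
Definition min_Cna (a b : R) (m n : nat) (alpha : R) (A : mfun) : Prop :=
  forall i j, (i < m)%nat -> (j < m)%nat -> in_Cna a b n alpha (A i j).

Definition vnorm (a b : R) (m n : nat) (alpha : R) (y : vfun) : R :=
  sumR (seq 0 m) (fun i => hnorm a b n alpha (y i)).
Definition mnorm (a b : R) (m n : nat) (alpha : R) (A : mfun) : R :=
  sumR (seq 0 m) (fun i => sumR (seq 0 m) (fun j => hnorm a b n alpha (A i j))).

Definition vsub (y z : vfun) : vfun := fun i t => Cminus (y i t) (z i t).
Definition msub (A B : mfun) : mfun := fun i j t => Cminus (A i j t) (B i j t).

(** Vectors of C^d are represented by [nat -> C], components k < d. *)
Definition vec_eq (d : nat) (u v : nat -> C) : Prop :=
  forall k, (k < d)%nat -> u k = v k.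
Definition csub (u v : nat -> C) : nat -> C := fun k => Cminus (u k) (v k).

Definition is_norm_on (d : nat) (N : (nat -> C) -> R) : Prop :=
  (forall u v, vec_eq d u v -> N u = N v) /\
  (forall u, 0 <= N u) /\
  (forall u, N u = 0 -> vec_eq d u (fun _ => RtoC 0)) /\
  (forall u v, N (fun k => Cplus (u k) (v k)) <= N u + N v) /\
  (forall (l : C) u, N (fun k => Cmult l (u k)) = Cmod l * N u).

Definition cont_lin_op (a b : R) (m p : nat) (alpha : R) (d : nat)
    (N : (nat -> C) -> R) (T : vfun -> nat -> C) : Prop :=
  (forall y z, vin_Cna a b m p alpha y -> vin_Cna a b m p alpha z ->
     vec_eq d (T (fun i t => Cplus (y i t) (z i t))) (fun k => Cplus (T y k) (T z k))) /\
  (forall (l : C) y, vin_Cna a b m p alpha y ->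
     vec_eq d (T (fun i t => Cmult l (y i t))) (fun k => Cmult l (T y k))) /\
  (exists K, forall y, vin_Cna a b m p alpha y -> N (T y) <= K * vnorm a b m p alpha y).

Definition Lop (a b : R) (m r : nat) (A : nat -> R -> mfun) (eps : R) (y : vfun) : vfun :=
  fun i t =>
    Cplus (derw a b (y i) r t)
      (sumC (seq 1 r) (fun j =>
         sumC (seq 0 m) (fun k => Cmult (A (r - j)%nat eps i k t) (derw a b (y k) (r - j)%nat t)))).

Definition is_sol (a b : R) (m n r : nat) (alpha : R) (A : nat -> R -> mfun)
    (B : R -> vfun -> nat -> C) (eps : R) (f : vfun) (c : nat -> C) (y : vfun) : Prop :=
  vin_Cna a b m (n + r) alpha y /\
  (forall i t, (i < m)%nat -> a <= t <= b -> Lop a b m r A eps y i t = f i t) /\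
  vec_eq (r * m) (B eps y) c.

(* Main.v *)
(* Write L(eps) and B(eps) for the operators of the problem, acting on the
   Hölder space of order n + r.  The Hölder spaces are complete, so Zabreiko's
   lemma (a Baire argument) yields both a bound of B(eps) that is uniform for
   small eps > 0 and a bounded right inverse G of L(0) with B(0) G = 0.
   Let w_k solve L(0) w_k = 0, B(0) w_k = e_k.  Every u equals
   G L(0) u + sum_k c_k w_k with c = B(0) u; as B(eps) w_k -> e_k, the vector c
   is controlled by B(eps) u and L(0) u, so that
   |u| <= K (|L(0) u| + |B(eps) u|) for small eps.  Since L(eps) -> L(0) in
   operator norm, L(0) may be replaced by L(eps); the reverse estimate is the
   uniform boundedness of (L(eps), B(eps)).  Both are applied to
   u = y(0) - y(eps). *)
Require Import Defs.
From Stdlib Require Import Reals List Lra Lia Classical ClassicalEpsilon.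
From Stdlib Require Import FunctionalExtensionality PropExtensionality.
From Coquelicot Require Import Coquelicot.
Open Scope R_scope.

(** Hypothesis (II) is only strong convergence, so (L(eps), B(eps)) is not a norm-small perturbation
    of (L(0), B(0)) and no Neumann series is available. The splitting of u gets around this: the
    limit of B(eps) matters only on the finitely many w_k, where strong convergence is automatically
    uniform, while on the range of G mere boundedness of B(eps) is enough, since that part is
    already controlled by L(0) u. No theory of differential equations enters: G and the w_k come
    from the assumed solvability at eps = 0, and only the boundedness of G has to be proved.

    Two features shape the statements. Functions live on all of R, but norms and equations see only
    [a,b] and the components below m; identities are therefore stated with [veq], and B(eps)
    respects this relation because it is bounded. Zabreiko's lemma is stated with a slack eta > 0,
    because a relation between points and bounds need not be closed in the bound; the slack is
    removed at the end, once it stands inside an inequality between numbers. *)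

Lemma choice (S T : Type) (Rel : S -> T -> Prop) :
  (forall x, exists y, Rel x y) -> exists f, forall x, Rel x (f x).
Proof.
  intros H. exists (fun x => proj1_sig (constructive_indefinite_description _ (H x))).
  intros x; apply proj2_sig.
Qed.

Lemma Cmod_minus_sym (x y : C) : Cmod (x - y)%C = Cmod (y - x)%C.
Proof. rewrite <- Cmod_opp; f_equal; ring. Qed.

Lemma Cmod_minus_triangle (x y z : C) :
  Cmod (x - z)%C <= Cmod (x - y)%C + Cmod (y - z)%C.
Proof.
  replace (x - z)%C with ((x - y) + (y - z))%C by ring; apply Cmod_triangle.
Qed.

Lemma Cmod_sub_le (x y : C) : Cmod (x - y)%C <= Cmod x + Cmod y.
Proof. unfold Cminus; rewrite <- (Cmod_opp y); apply Cmod_triangle. Qed.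

Lemma Cmod_le_eps_0 (x : C) : (forall e, 0 < e -> Cmod x <= e) -> x = RtoC 0.
Proof.
  intros H; apply Cmod_eq_0; apply Rle_antisym; [|apply Cmod_ge_0].
  apply le_epsilon; intros e He; rewrite Rplus_0_l; auto.
Qed.

(** [real] returns 0 at an infinite [Lub_Rbar]; a member and an upper bound of E exclude that
    case. *)
Lemma real_Lub_Rbar_bounds (E : R -> Prop) (M v : R) :
  E v -> (forall w, E w -> w <= M) ->
  v <= real (Lub_Rbar E) <= M.
Proof.
  intros Hv HM. destruct (Lub_Rbar_correct E) as [H1 H2].
  specialize (H1 v Hv).
  assert (H3 : Rbar_le (Lub_Rbar E) M) by (apply H2; intros w Hw; apply HM, Hw).
  destruct (Lub_Rbar E); simpl in *; tauto || lra.
Qed.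

Lemma Rpower_pos (x y : R) : 0 < Rpower x y.
Proof. apply exp_pos. Qed.

(** * Sequences with a geometric rate of convergence *)

Lemma half_pow_pos (k : nat) : 0 < (/ 2) ^ k.
Proof. apply pow_lt; lra. Qed.

Lemma half_pow_small (D e : R) : 0 < e -> exists k, D * (/ 2) ^ k < e.
Proof.
  intros He. assert (P := Rabs_pos D).
  destruct (pow_lt_1_zero (/ 2) ltac:(rewrite Rabs_pos_eq; lra) (e / (Rabs D + 1)))
    as [k Hk]; [apply Rdiv_lt_0_compat; lra|].
  exists k. specialize (Hk k (le_n k)). assert (Q := half_pow_pos k).
  rewrite Rabs_pos_eq in Hk by lra.
  apply Rle_lt_trans with ((Rabs D + 1) * (/ 2) ^ k).
  - apply Rmult_le_compat_r; [lra|]. assert (R := Rle_abs D); lra.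
  - apply Rmult_lt_compat_l with (r := Rabs D + 1) in Hk; [|lra].
    replace ((Rabs D + 1) * (e / (Rabs D + 1))) with e in Hk by (field; lra). exact Hk.
Qed.

Lemma le_of_half_pow (x y D : R) : (forall k, x <= y + D * (/ 2) ^ k) -> x <= y.
Proof.
  intros H; apply le_epsilon; intros e He. destruct (half_pow_small D e He) as [k Hk].
  specialize (H k); lra.
Qed.

(** The right-hand side is the exact value of the geometric sum from k to j + k - 1, which is what
    makes the induction on j close. *)
Lemma geometric_step (z : nat -> C) (c : R) :
  (forall k, Cmod (z (S k) - z k)%C <= c * (/ 2) ^ k) ->
  forall k j, Cmod (z (j + k)%nat - z k)%C <= 2 * c * (/ 2) ^ k - 2 * c * (/ 2) ^ (j + k).
Proof.
  intros H k j; induction j as [|j IH].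
  - simpl. replace (z k - z k)%C with (RtoC 0) by ring. rewrite Cmod_0; lra.
  - eapply Rle_trans; [apply (Cmod_minus_triangle _ (z (j + k)%nat))|].
    specialize (H (j + k)%nat). change (S j + k)%nat with (S (j + k)).
    rewrite <- tech_pow_Rmult. lra.
Qed.

(** Any crude rate D identifies the limit; the final constant then depends on the increments alone.
    This is how Hölder and Lipschitz bounds of increments pass to a limit. *)
Lemma geometric_limit_bound (z : nat -> C) (l : C) (c D : R) :
  (forall k, Cmod (z (S k) - z k)%C <= c * (/ 2) ^ k) ->
  (forall k, Cmod (l - z k)%C <= D * (/ 2) ^ k) ->
  forall k, Cmod (l - z k)%C <= 2 * c * (/ 2) ^ k.
Proof.
  intros H Hl k. apply le_of_half_pow with D; intros j.
  eapply Rle_trans; [apply (Cmod_minus_triangle _ (z (j + k)%nat))|].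
  assert (H1 := geometric_step z c H k j). specialize (Hl (j + k)%nat).
  assert (Hc : 0 <= c).
  { specialize (H 0%nat). rewrite pow_O, Rmult_1_r in H.
    eapply Rle_trans; [apply Cmod_ge_0|exact H]. }
  assert (P := half_pow_pos (j + k)).
  assert (HD : 0 <= D).
  { apply Rmult_le_reg_r with ((/ 2) ^ (j + k)); auto. rewrite Rmult_0_l.
    eapply Rle_trans; [apply Cmod_ge_0|exact Hl]. }
  assert (H2 : D * (/ 2) ^ (j + k) <= D * (/ 2) ^ j).
  { apply Rmult_le_compat_l; auto.
    assert (Q : (/ 2) ^ k <= 1) by (rewrite <- (pow1 k); apply pow_incr; lra).
    assert (Qj := half_pow_pos j). rewrite pow_add.
    apply Rmult_le_compat_l with (r := (/ 2) ^ j) in Q; lra. }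
  assert (0 <= c * (/ 2) ^ (j + k)) by (apply Rmult_le_pos; lra). lra.
Qed.

Lemma real_geometric_cv (x : nat -> R) (c : R) :
  (forall k j, Rabs (x (j + k)%nat - x k) <= c * (/ 2) ^ k) ->
  exists l, forall k, Rabs (l - x k) <= c * (/ 2) ^ k.
Proof.
  intros H. destruct (Rcomplete.R_complete x) as [l Hl].
  { intros e He. destruct (half_pow_small c (e / 2) ltac:(lra)) as [N HN].
    exists N; intros p q Hp Hq. unfold Rdist.
    assert (H1 := H N (p - N)%nat). assert (H2 := H N (q - N)%nat).
    replace (p - N + N)%nat with p in H1 by lia. replace (q - N + N)%nat with q in H2 by lia.
    replace (x p - x q) with ((x p - x N) - (x q - x N)) by ring.
    eapply Rle_lt_trans; [apply Rabs_triang|]. rewrite Rabs_Ropp; lra. }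
  exists l; intros k. apply le_epsilon; intros e He.
  destruct (Hl e He) as [N HN].
  specialize (HN (N + k)%nat ltac:(lia)). specialize (H k N). unfold Rdist in HN.
  replace (l - x k) with ((x (N + k)%nat - x k) - (x (N + k)%nat - l)) by ring.
  eapply Rle_trans; [apply Rabs_triang|]. rewrite Rabs_Ropp; lra.
Qed.

Lemma geometric_cv (z : nat -> C) (c : R) :
  (forall k, Cmod (z (S k) - z k)%C <= c * (/ 2) ^ k) ->
  exists l, forall k, Cmod (l - z k)%C <= 2 * c * (/ 2) ^ k.
Proof.
  intros H.
  assert (Hb : forall k j, Cmod (z (j + k)%nat - z k)%C <= 2 * c * (/ 2) ^ k).
  { intros k j. eapply Rle_trans; [apply geometric_step, H|].
    assert (P := half_pow_pos (j + k)). specialize (H 0%nat).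
    rewrite pow_O, Rmult_1_r in H. assert (Hc := Rle_trans _ _ _ (Cmod_ge_0 _) H).
    assert (0 <= c * (/ 2) ^ (j + k)) by (apply Rmult_le_pos; lra). lra. }
  assert (Hm : forall u v : C, Rabs (fst u - fst v) <= Cmod (u - v)%C
                            /\ Rabs (snd u - snd v) <= Cmod (u - v)%C).
  { intros u v. assert (M := Rmax_Cmod (u - v)%C).
    split; (eapply Rle_trans; [|exact M]); [apply Rmax_l|apply Rmax_r]. }
  destruct (real_geometric_cv (fun k => fst (z k)) (2 * c)) as [l1 H1].
  { intros k j; eapply Rle_trans; [apply Hm|apply Hb]. }
  destruct (real_geometric_cv (fun k => snd (z k)) (2 * c)) as [l2 H2].
  { intros k j; eapply Rle_trans; [apply Hm|apply Hb]. }
  (* Recombining the two coordinates costs a factor sqrt 2, which [geometric_limit_bound]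
     recovers. *)
  exists (l1, l2). apply geometric_limit_bound with (sqrt 2 * (2 * c)); auto.
  intros k. eapply Rle_trans; [apply Cmod_2Rmax|]. rewrite Rmult_assoc.
  apply Rmult_le_compat_l; [apply sqrt_pos|]. apply Rmax_lub; [apply H1|apply H2].
Qed.

(** * Finite sums *)

Lemma sumR_map (l : list nat) (h : nat -> nat) (F : nat -> R) :
  sumR (map h l) F = sumR l (fun i => F (h i)).
Proof. induction l as [|i l IH]; simpl; [reflexivity|rewrite IH; reflexivity]. Qed.

Lemma sumR_seq_S (n : nat) (F : nat -> R) :
  sumR (seq 0 (S n)) F = F 0%nat + sumR (seq 0 n) (fun i => F (S i)).
Proof.
  change (sumR (seq 0 (S n)) F) with (F 0%nat + sumR (seq 1 n) F).
  rewrite <- seq_shift, sumR_map; reflexivity.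
Qed.

Lemma sumR_le (l : list nat) (F G : nat -> R) :
  (forall i, In i l -> F i <= G i) -> sumR l F <= sumR l G.
Proof.
  induction l as [|i l IH]; intros H; simpl; [lra|].
  apply Rplus_le_compat; [apply H; left; auto|apply IH; intros; apply H; right; auto].
Qed.

Lemma sumR_ext (l : list nat) (F G : nat -> R) :
  (forall i, In i l -> F i = G i) -> sumR l F = sumR l G.
Proof. intros H; apply Rle_antisym; apply sumR_le; intros i Hi; rewrite H; auto; lra. Qed.

Lemma sumR_plus (l : list nat) (F G : nat -> R) :
  sumR l (fun i => F i + G i) = sumR l F + sumR l G.
Proof. induction l as [|i l IH]; simpl; [ring|rewrite IH; ring]. Qed.

Lemma sumR_scal (l : list nat) (c : R) (F : nat -> R) :
  sumR l (fun i => c * F i) = c * sumR l F.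
Proof. induction l as [|i l IH]; simpl; [ring|rewrite IH; ring]. Qed.

Lemma sumR_const (l : list nat) (c : R) : sumR l (fun _ => c) = INR (length l) * c.
Proof.
  induction l as [|i l IH]; cbn [sumR fold_right length]; [simpl; ring|].
  change (c + sumR l (fun _ => c) = INR (S (length l)) * c). rewrite IH, S_INR; ring.
Qed.

Lemma sumR_ge_0 (l : list nat) (F : nat -> R) :
  (forall i, In i l -> 0 <= F i) -> 0 <= sumR l F.
Proof.
  intros H. apply Rle_trans with (sumR l (fun _ => 0)); [rewrite sumR_const; lra|].
  apply sumR_le; auto.
Qed.

Lemma sumR_ge_term (l : list nat) (F : nat -> R) (i : nat) :
  (forall i, In i l -> 0 <= F i) -> In i l -> F i <= sumR l F.
Proof.
  induction l as [|k l IH]; intros H Hi; [destruct Hi|]. simpl.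
  assert (H1 := sumR_ge_0 l F (fun i Hi => H i (or_intror Hi))).
  destruct Hi as [->|Hi]; [lra|].
  specialize (IH (fun i Hi => H i (or_intror Hi)) Hi).
  specialize (H k (or_introl eq_refl)). lra.
Qed.

Lemma sumC_ext (l : list nat) (F G : nat -> C) :
  (forall i, In i l -> F i = G i) -> sumC l F = sumC l G.
Proof.
  induction l as [|i l IH]; intros H; simpl; [auto|].
  rewrite IH, H; auto using in_eq, in_cons.
Qed.

Lemma sumC_plus (l : list nat) (F G : nat -> C) :
  sumC l (fun i => F i + G i)%C = (sumC l F + sumC l G)%C.
Proof. induction l as [|i l IH]; simpl; [ring|rewrite IH; ring]. Qed.

Lemma sumC_scal (l : list nat) (c : C) (F : nat -> C) :
  sumC l (fun i => c * F i)%C = (c * sumC l F)%C.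
Proof. induction l as [|i l IH]; simpl; [ring|rewrite IH; ring]. Qed.

Lemma in_seq0 (i d : nat) : In i (seq 0 d) <-> (i < d)%nat.
Proof. rewrite in_seq; lia. Qed.

Lemma bounded_prefix (f : nat -> R) (k : nat) : exists M, forall i, (i < k)%nat -> f i <= M.
Proof.
  induction k as [|k [M HM]]; [exists 0; intros; lia|].
  exists (Rmax M (f k)). intros i Hi. destruct (Nat.eq_dec i k) as [->|Hne]; [apply Rmax_r|].
  eapply Rle_trans; [apply HM; lia|apply Rmax_l].
Qed.

(** * Operations on vector functions and properties valid near 0+ *)

Definition vadd (y z : vfun) : vfun := fun i t => Cplus (y i t) (z i t).
Definition vscal (l : C) (y : vfun) : vfun := fun i t => Cmult l (y i t).

Lemma vsub_vadd (y z : vfun) : vsub y z = vadd y (vscal (RtoC (-1)) z).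
Proof.
  apply functional_extensionality; intros i; apply functional_extensionality; intros t.
  unfold vsub, vadd, vscal; ring.
Qed.

Definition near0 (P : R -> Prop) : Prop :=
  exists d, 0 < d /\ forall eps, 0 < eps < d -> P eps.

Lemma near0_and (P Q : R -> Prop) : near0 P -> near0 Q -> near0 (fun e => P e /\ Q e).
Proof.
  intros (d1 & H1 & HP) (d2 & H2 & HQ). exists (Rmin d1 d2); split; [apply Rmin_pos; auto|].
  intros e [He1 He2]. apply Rmin_Rgt_l in He2 as [He2 He3]. split; [apply HP|apply HQ]; lra.
Qed.

Lemma near0_imp (P Q : R -> Prop) : (forall e, 0 < e -> P e -> Q e) -> near0 P -> near0 Q.
Proof. intros H (d & Hd & HP). exists d; split; auto. intros e He; apply H; [lra|auto]. Qed.

Lemma near0_lt (d : R) : 0 < d -> near0 (fun e => e < d).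
Proof. intros Hd; exists d; split; auto; intros; lra. Qed.

Lemma near0_forall_lt (P : nat -> R -> Prop) (k : nat) :
  (forall i, (i < k)%nat -> near0 (P i)) -> near0 (fun e => forall i, (i < k)%nat -> P i e).
Proof.
  induction k as [|k IH]; intros H.
  - exists 1; split; [lra|]. intros; lia.
  - assert (H1 := IH (fun i Hi => H i (Nat.lt_lt_succ_r _ _ Hi))).
    refine (near0_imp _ _ _ (near0_and _ _ H1 (H k ltac:(lia)))).
    intros e _ [H2 H3] i Hi. destruct (Nat.eq_dec i k) as [->|Hne]; auto. apply H2; lia.
Qed.

(** * Zabreiko's lemma *)

(** A successor exists only from states satisfying [Inv], so the invariant has to be established
    along with the sequence; [epsilon] makes the choices. *)
Lemma dependent_choice_nat (T : Type) (Inv : nat -> T -> Prop) (Rel : nat -> T -> T -> Prop) (t0 : T) :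
  Inv 0%nat t0 ->
  (forall k t, Inv k t -> exists t', Inv (S k) t' /\ Rel k t t') ->
  exists f : nat -> T, f 0%nat = t0 /\ forall k, Inv k (f k) /\ Rel k (f k) (f (S k)).
Proof.
  intros H0 Hs.
  pose (f := nat_rect (fun _ => T) t0
    (fun k t => epsilon (inhabits t0) (fun t' => Inv (S k) t' /\ Rel k t t'))).
  assert (Hf : forall k, Inv k (f k) -> Inv (S k) (f (S k)) /\ Rel k (f k) (f (S k))).
  { intros k Hk. simpl. apply epsilon_spec, Hs, Hk. }
  assert (HI : forall k, Inv k (f k)) by (induction k; [exact H0|apply Hf; auto]).
  exists f; split; [reflexivity|]. intros k; split; auto. apply Hf; auto.
Qed.

Section Zabreiko.

(* [Q x M] reads "x has bound M".  A relation instead of a seminorm lets one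
   lemma serve both the uniform boundedness principle ([N (B_k x) <= M] for all
   k) and the open mapping theorem (x has a preimage of norm at most M). *)
Context (P : vfun -> Prop) (q : vfun -> R) (Q : vfun -> R -> Prop).

Context (HP0 : P (fun _ _ => RtoC 0)).
Context (Hsub : forall x y, P x -> P y -> P (vsub x y) /\ q (vsub x y) <= q x + q y).
Context (Hscal : forall l x, P x -> P (vscal l x) /\ q (vscal l x) <= Cmod l * q x).
Context (Hq0 : forall x, P x -> 0 <= q x).
(** Completeness in the form used below: a sequence whose increments decay geometrically converges,
    again at a geometric rate, with some unspecified constant. *)
Context (Hcomplete : forall (u : nat -> vfun) (c : R), (forall k, P (u k)) ->
  (forall k, q (vsub (u (S k)) (u k)) <= c * (/ 2) ^ k) ->
  exists x D, P x /\ forall k, q (vsub x (u k)) <= D * (/ 2) ^ k).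
Context (HQ : forall x, P x -> exists M, Q x M).
Context (HQmono : forall x M M', M <= M' -> Q x M -> Q x M').
Context (HQsub : forall x y M M', P x -> P y -> Q x M -> Q y M' -> Q (vsub x y) (M + M')).
Context (HQscal : forall s x M, P x -> 0 < s -> Q x M -> Q (vscal (RtoC s) x) (s * M)).
(** Countable subadditivity, the key hypothesis of Zabreiko's lemma. The u k are the partial sums of
    a series for x whose terms have bounds M / 2^k; these add up to 2 M. *)
Context (HQcount : forall x (u : nat -> vfun) M D, P x -> (forall k, P (u k)) ->
  u 0%nat = (fun _ _ => RtoC 0) ->
  (forall k, Q (vsub (u (S k)) (u k)) (M * (/ 2) ^ k)) ->
  (forall k, q (vsub x (u k)) <= D * (/ 2) ^ k) -> Q x (2 * M)).

Ltac vring := apply functional_extensionality; intros i; apply functional_extensionality; intros t;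
  unfold vsub, vscal, vadd; ring.

Lemma seminorm_tri (x y z : vfun) : P x -> P y -> P z ->
  q (vsub x z) <= q (vsub x y) + q (vsub y z).
Proof.
  intros Hx Hy Hz.
  assert (Hyz := proj1 (Hsub _ _ Hy Hz)). assert (Hxy := proj1 (Hsub _ _ Hx Hy)).
  destruct (Hscal (RtoC (-1)) _ Hyz) as [H1 H2].
  rewrite Cmod_R, Rabs_left in H2 by lra.
  replace (vsub x z) with (vsub (vsub x y) (vscal (RtoC (-1)) (vsub y z))) by vring.
  eapply Rle_trans; [apply (Hsub _ _ Hxy H1)|]. lra.
Qed.

Lemma seminorm_sym (x y : vfun) : P x -> P y -> q (vsub x y) <= q (vsub y x).
Proof.
  intros Hx Hy. replace (vsub x y) with (vscal (RtoC (-1)) (vsub y x)) by vring.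
  eapply Rle_trans; [apply Hscal, Hsub; auto|]. rewrite Cmod_R, Rabs_left; lra.
Qed.

(* Baire's argument: were no sublevel set of [Q] dense in a ball, nested balls
   avoiding the successive sublevel sets would shrink to a point without a bound. *)
Lemma sublevel_somewhere_dense :
  exists (k : nat) (y : vfun) (rho : R), P y /\ 0 < rho /\
    forall z, P z -> q (vsub z y) <= rho -> forall d, 0 < d ->
      exists w, P w /\ Q w (INR k) /\ q (vsub z w) <= d.
Proof.
  apply NNPP; intros Hno.
  (* A state is a centre with a radius. Moving the centre by at most half the radius while halving
     the radius keeps the balls nested. *)
  pose (Inv := fun (k : nat) (p : vfun * R) => P (fst p) /\ 0 < snd p <= (/ 2) ^ k).
  pose (Rel := fun (k : nat) (p p' : vfun * R) =>
    q (vsub (fst p') (fst p)) <= snd p / 2 /\ snd p' <= snd p / 2 /\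
    forall z, P z -> q (vsub z (fst p')) <= snd p' -> ~ Q z (INR k)).
  destruct (dependent_choice_nat _ Inv Rel ((fun _ _ => RtoC 0), 1)) as (f & _ & Hf).
  { split; simpl; auto; lra. }
  { intros k [y rho] [Hy Hrho]; simpl in *.
    apply NNPP; intros Hstep. apply Hno.
    exists k, y, (rho / 2). split; [auto|split; [lra|]].
    intros z Hz Hzy d Hd. apply NNPP; intros Hw. apply Hstep.
    (* The first term makes every point of the new ball closer than d to z, hence a point without
       bound k; the second gives nesting. *)
    exists (z, Rmin (d / 2) (rho / 2)). repeat split; simpl; auto.
    - apply Rmin_pos; lra.
    - eapply Rle_trans; [apply Rmin_r|]. lra.
    - apply Rmin_r.
    - intros w HPw Hqw HQw. apply Hw. exists w; repeat split; auto.
      eapply Rle_trans; [apply seminorm_sym; auto|]. eapply Rle_trans; [exact Hqw|].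
      eapply Rle_trans; [apply Rmin_l|]. lra. }
  assert (HfP : forall k, P (fst (f k))) by (intros k; apply (Hf k)).
  destruct (Hcomplete (fun k => fst (f k)) 1 HfP) as (x & D & Hx & HD).
  { intros k. destruct (Hf k) as [[_ H1] [H2 _]]. assert (H3 := half_pow_pos k). lra. }
  (* Bounding the distance by the difference of radii, rather than by the radius, lets the triangle
     inequality telescope along the nested balls. *)
  assert (Hball : forall k j, q (vsub (fst (f (j + k)%nat)) (fst (f k)))
                                <= snd (f k) - snd (f (j + k)%nat)).
  { intros k j; induction j as [|j IH].
    - simpl. destruct (Hscal (RtoC 0) _ (HfP k)) as [H1 H2].
      replace (vsub (fst (f k)) (fst (f k))) with (vscal (RtoC 0) (fst (f k))) by vring.
      rewrite Cmod_0 in H2. lra.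
    - destruct (Hf (j + k)%nat) as [[_ H1] (H2 & H3 & _)].
      change (S j + k)%nat with (S (j + k)).
      eapply Rle_trans; [apply (seminorm_tri _ (fst (f (j + k)%nat))); auto|]. lra. }
  (* The limit lies in every ball, in particular in ball k + 1, none of whose points has bound k;
     but x has a bound M < k. *)
  destruct (HQ x Hx) as [M HM]. destruct (INR_unbounded M) as [k Hk].
  destruct (Hf k) as [_ (_ & _ & Hav)]. apply (Hav x Hx).
  - apply le_of_half_pow with D; intros j.
    eapply Rle_trans; [apply (seminorm_tri _ (fst (f (j + S k)%nat))); auto|].
    specialize (Hball (S k) j). specialize (HD (j + S k)%nat). simpl in HD.
    destruct (Hf (j + S k)%nat) as [[_ H1] _].
    assert (HD0 : 0 <= D).
    { apply Rnot_lt_le; intros Hlt.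
      assert (H2 := Hq0 _ (proj1 (Hsub _ _ Hx (HfP (j + S k)%nat)))).
      assert (H3 := half_pow_pos (j + S k)).
      assert (D * (/ 2) ^ (j + S k) < 0) by (apply Rmult_neg_pos; auto). lra. }
    assert (D * (/ 2) ^ (j + S k) <= D * (/ 2) ^ j).
    { apply Rmult_le_compat_l; auto.
      assert (H2 : (/ 2) ^ S k <= 1) by (rewrite <- (pow1 (S k)); apply pow_incr; lra).
      assert (H3 := half_pow_pos j). rewrite pow_add.
      apply Rmult_le_compat_l with (r := (/ 2) ^ j) in H2; lra. }
    lra.
  - apply HQmono with M; [lra|auto].
Qed.

(** The successive approximation of the open mapping theorem. Density of a sublevel set in some ball
    is moved to the origin by symmetry; each residual is then approximated to half its size with a
    correction of proportional bound, and [HQcount] sums the corrections. Homogeneity extends the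
    result from a ball to the whole space. *)
Lemma zabreiko :
  exists K, 0 < K /\ forall x eta, P x -> 0 < eta -> Q x (K * (q x + eta)).
Proof.
  destruct sublevel_somewhere_dense as (k0 & y & rho & Hy & Hrho & Hdense).
  (* k0 may be 0; adding 1 makes the bound positive. *)
  set (M := INR k0 + 1).
  assert (HM : 0 < M) by (assert (H := pos_INR k0); unfold M; lra).
  (* Since z = ((y + z) - (y - z)) / 2, approximating y + z by w1 and y - z by w2 within rho / 2
     approximates z by (w1 - w2) / 2 equally well. *)
  assert (unit_ball : forall z, P z -> q z <= rho ->
    exists w, P w /\ Q w M /\ q (vsub z w) <= rho / 2).
  { intros z Hz Hqz.
    assert (Hz' := proj1 (Hscal (RtoC (-1)) z Hz)).
    assert (Hqz' : q (vscal (RtoC (-1)) z) <= rho).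
    { eapply Rle_trans; [apply Hscal; auto|]. rewrite Cmod_R, Rabs_left; lra. }
    assert (Py1 := proj1 (Hsub _ _ Hy Hz')). assert (Py2 := proj1 (Hsub _ _ Hy Hz)).
    destruct (Hdense _ Py1) with (d := rho / 2) as (w1 & P1 & Q1 & D1); [|lra|].
    { replace (vsub (vsub y (vscal (RtoC (-1)) z)) y) with z by vring. auto. }
    destruct (Hdense _ Py2) with (d := rho / 2) as (w2 & P2 & Q2 & D2); [|lra|].
    { replace (vsub (vsub y z) y) with (vscal (RtoC (-1)) z) by vring. auto. }
    exists (vscal (RtoC (/ 2)) (vsub w1 w2)).
    assert (P12 := proj1 (Hsub _ _ P1 P2)). split; [apply Hscal; auto|split].
    - apply HQmono with (/ 2 * (INR k0 + INR k0)); [unfold M; lra|].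
      apply HQscal; auto; lra.
    - replace (vsub z (vscal (RtoC (/ 2)) (vsub w1 w2))) with
        (vscal (RtoC (/ 2)) (vsub (vsub (vsub y (vscal (RtoC (-1)) z)) w1)
                                  (vsub (vsub y z) w2))).
      + assert (E1 := proj1 (Hsub _ _ Py1 P1)). assert (E2 := proj1 (Hsub _ _ Py2 P2)).
        eapply Rle_trans; [apply Hscal, Hsub; auto|].
        rewrite Cmod_R, Rabs_pos_eq by lra.
        assert (E3 := proj2 (Hsub _ _ E1 E2)). lra.
      + apply functional_extensionality; intros i; apply functional_extensionality; intros t.
        unfold vsub, vscal. rewrite RtoC_inv by lra. field. }
  assert (ball : forall s z, 0 < s -> P z -> q z <= rho * s ->
    exists w, P w /\ Q w (M * s) /\ q (vsub z w) <= rho * (s / 2)).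
  { intros s z Hs Hz Hqz.
    assert (Hs' : 0 < / s) by (apply Rinv_0_lt_compat; auto).
    destruct (unit_ball (vscal (RtoC (/ s)) z)) as (w & Pw & Qw & Dw).
    - apply Hscal; auto.
    - eapply Rle_trans; [apply Hscal; auto|]. rewrite Cmod_R, Rabs_pos_eq by lra.
      apply Rmult_le_reg_l with s; auto. rewrite <- Rmult_assoc, Rinv_r by lra. lra.
    - exists (vscal (RtoC s) w). split; [apply Hscal; auto|split].
      + rewrite Rmult_comm. apply HQscal; auto.
      + replace (vsub z (vscal (RtoC s) w)) with
          (vscal (RtoC s) (vsub (vscal (RtoC (/ s)) z) w)).
        * eapply Rle_trans; [apply Hscal, Hsub; auto; apply Hscal; auto|].
          rewrite Cmod_R, Rabs_pos_eq by lra.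
          apply Rmult_le_compat_l with (r := s) in Dw; lra.
        * apply functional_extensionality; intros i; apply functional_extensionality; intros t.
          unfold vsub, vscal. rewrite RtoC_inv by lra. field.
          intros E; apply RtoC_inj in E; lra. }
  (* The approximation u is corrected by a w that approximates the residual x - u, so the residual
     after k steps is at most rho / 2^k. *)
  assert (rho_ball : forall x, P x -> q x <= rho -> Q x (2 * M)).
  { intros x Hx Hqx.
    destruct (dependent_choice_nat vfun
      (fun k u => P u /\ q (vsub x u) <= rho * (/ 2) ^ k)
      (fun k u u' => Q (vsub u' u) (M * (/ 2) ^ k)) (fun _ _ => RtoC 0)) as (u & Hu0 & Hu).
    - split; auto. replace (vsub x (fun _ _ => RtoC 0)) with x by vring. simpl; lra.
    - intros k u [Pu Du].
      destruct (ball ((/ 2) ^ k) (vsub x u)) as (w & Pw & Qw & Dw); auto using half_pow_pos.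
      { apply Hsub; auto. }
      exists (vsub u (vscal (RtoC (-1)) w)). split; [split|].
      + apply Hsub; auto; apply Hscal; auto.
      + replace (vsub x (vsub u (vscal (RtoC (-1)) w))) with (vsub (vsub x u) w) by vring.
        simpl. lra.
      + replace (vsub (vsub u (vscal (RtoC (-1)) w)) u) with w by vring. exact Qw.
    - apply HQcount with u rho; auto; intros k; apply (Hu k). }
  exists (2 * M / rho); split; [apply Rdiv_lt_0_compat; lra|].
  intros x eta Hx Heta. assert (Hqx := Hq0 x Hx).
  (* Dividing x by s brings it into the ball of radius rho; eta keeps s positive when q x = 0. *)
  set (s := (q x + eta) / rho).
  assert (Hs : 0 < s) by (apply Rdiv_lt_0_compat; lra).
  assert (Hs' : 0 < / s) by (apply Rinv_0_lt_compat; auto).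
  replace (2 * M / rho * (q x + eta)) with (s * (2 * M)) by (unfold s; field; lra).
  replace x with (vscal (RtoC s) (vscal (RtoC (/ s)) x)).
  - apply HQscal; auto; [apply Hscal; auto|].
    apply rho_ball; [apply Hscal; auto|].
    eapply Rle_trans; [apply Hscal; auto|]. rewrite Cmod_R, Rabs_pos_eq by lra.
    apply Rmult_le_reg_l with s; auto. rewrite <- Rmult_assoc, Rinv_r by lra.
    unfold s, Rdiv; rewrite Rmult_assoc, Rinv_l by lra. lra.
  - apply functional_extensionality; intros i; apply functional_extensionality; intros t.
    unfold vscal. rewrite RtoC_inv by lra. field. intros E; apply RtoC_inj in E; lra.
Qed.

End Zabreiko.

(** * Norms on C^d *)

Definition unit_vec (k : nat) : nat -> C := fun j => if Nat.eqb j k then RtoC 1 else RtoC 0.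

Lemma sumC_unit_vec (d j : nat) (c : nat -> C) :
  (j < d)%nat -> sumC (seq 0 d) (fun k => c k * unit_vec k j)%C = c j.
Proof.
  assert (H : forall l, NoDup l ->
    sumC l (fun k => c k * unit_vec k j)%C = if in_dec Nat.eq_dec j l then c j else RtoC 0).
  { induction l as [|k l IH]; intros Hl; [reflexivity|].
    apply NoDup_cons_iff in Hl as [Hk Hl]. cbn [sumC fold_right].
    change (c k * unit_vec k j + sumC l (fun k => c k * unit_vec k j)
            = if in_dec Nat.eq_dec j (k :: l) then c j else RtoC 0)%C.
    rewrite IH by auto. unfold unit_vec.
    destruct (Nat.eqb_spec j k) as [->|Hne].
    - destruct (in_dec _ k l); [tauto|]. destruct (in_dec _ k (k :: l)) as [|Hn]; [ring|].
      destruct Hn; left; auto.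
    - destruct (in_dec _ j l), (in_dec _ j (k :: l)) as [Hi|Hi]; try ring.
      + destruct Hi; right; auto.
      + destruct Hi; congruence. }
  intros Hj. rewrite H by apply seq_NoDup.
  destruct in_dec as [|Hn]; auto. destruct Hn; apply in_seq0; auto.
Qed.

Section Norm.

Context (d : nat) (N : (nat -> C) -> R) (HN : is_norm_on d N).

Lemma norm_ext (u v : nat -> C) : vec_eq d u v -> N u = N v.
Proof. apply HN. Qed.

Lemma norm_ge_0 (u : nat -> C) : 0 <= N u.
Proof. apply HN. Qed.

Lemma norm_plus (u v : nat -> C) : N (fun k => Cplus (u k) (v k)) <= N u + N v.
Proof. apply HN. Qed.

Lemma norm_scal (l : C) (u : nat -> C) : N (fun k => Cmult l (u k)) = Cmod l * N u.
Proof. apply HN. Qed.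

Lemma norm_eq_0 (u : nat -> C) : N u <= 0 -> vec_eq d u (fun _ => RtoC 0).
Proof. intros H; apply HN, Rle_antisym; auto. apply norm_ge_0. Qed.

Lemma norm_0 : N (fun _ => RtoC 0) = 0.
Proof.
  replace (fun _ : nat => RtoC 0) with (fun _ : nat => Cmult (RtoC 0) (RtoC 0))
    by (apply functional_extensionality; intros k; ring).
  rewrite norm_scal, Cmod_0; ring.
Qed.

Lemma norm_csub_sym (u v : nat -> C) : N (csub u v) = N (csub v u).
Proof.
  replace (csub u v) with (fun k => Cmult (RtoC (-1)) (csub v u k))
    by (apply functional_extensionality; intros k; unfold csub; ring).
  rewrite norm_scal, Cmod_R, Rabs_left; lra.
Qed.

Lemma norm_csub_tri (u v w : nat -> C) : N (csub u w) <= N (csub u v) + N (csub v w).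
Proof.
  replace (csub u w) with (fun k => Cplus (csub u v k) (csub v w k))
    by (apply functional_extensionality; intros k; unfold csub; ring).
  apply norm_plus.
Qed.

Lemma norm_le_csub (u v : nat -> C) : N u <= N v + N (csub u v).
Proof.
  replace u with (fun k => Cplus (v k) (csub u v k)) at 1
    by (apply functional_extensionality; intros k; unfold csub; ring).
  apply norm_plus.
Qed.

Lemma norm_csub_le (u v : nat -> C) : N (csub u v) <= N u + N v.
Proof.
  replace (csub u v) with (fun k => Cplus (u k) (Cmult (RtoC (-1)) (v k)))
    by (apply functional_extensionality; intros k; unfold csub; ring).
  eapply Rle_trans; [apply norm_plus|]. rewrite norm_scal, Cmod_R, Rabs_left; lra.
Qed.

Lemma norm_sumC (l : list nat) (c : nat -> C) (z : nat -> nat -> C) :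
  N (fun j => sumC l (fun k => c k * z k j)%C) <= sumR l (fun k => Cmod (c k) * N (z k)).
Proof.
  induction l as [|k l IH]; simpl.
  - rewrite norm_0; lra.
  - eapply Rle_trans; [apply norm_plus|]. rewrite norm_scal. apply Rplus_le_compat_l, IH.
Qed.

Lemma norm_le_coords (u : nat -> C) :
  N u <= sumR (seq 0 d) (fun k => Cmod (u k) * N (unit_vec k)).
Proof.
  rewrite (norm_ext u (fun j => sumC (seq 0 d) (fun k => u k * unit_vec k j)%C)).
  - apply norm_sumC.
  - intros j Hj; symmetry; apply sumC_unit_vec; auto.
Qed.

(* Induction on the dimension [e]: the span of the first [e] unit vectors is
   complete, hence closed, so the next unit vector has positive distance to it. *)
Lemma norm_coords_supported (e : nat) :
  (e <= d)%nat -> exists K, 0 <= K /\ forall c : nat -> C,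
    (forall k, (e <= k)%nat -> c k = RtoC 0) -> forall k, Cmod (c k) <= K * N c.
Proof.
  induction e as [|e IH]; intros He.
  { exists 0; split; [lra|]. intros c Hc k. rewrite Hc, Cmod_0 by lia. lra. }
  destruct (IH ltac:(lia)) as (K & HK & HKc).
  assert (Hdist : exists delta, 0 < delta /\ forall s : nat -> C,
    (forall k, (e <= k)%nat -> s k = RtoC 0) -> delta <= N (csub (unit_vec e) s)).
  { apply NNPP; intros Hno.
    assert (Hex : forall k, exists s : nat -> C,
      (forall j, (e <= j)%nat -> s j = RtoC 0) /\ N (csub (unit_vec e) s) <= (/ 2) ^ k).
    { intros k; apply NNPP; intros Hk. apply Hno. exists ((/ 2) ^ k); split; [apply half_pow_pos|].
      intros s Hs. apply Rnot_lt_le; intros Hlt. apply Hk; exists s; split; auto; lra. }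
    apply choice in Hex as [s Hs].
    (* Differences of the s k are supported below e, so the induction hypothesis turns closeness in
       N into closeness of coordinates. *)
    assert (Hlim : forall j, exists l : C, forall k, Cmod (l - s k j)%C <= 2 * (2 * K) * (/ 2) ^ k).
    { intros j; apply geometric_cv; intros k.
      change (Cmod (csub (s (S k)) (s k) j) <= 2 * K * (/ 2) ^ k).
      eapply Rle_trans; [apply HKc|].
      - intros i Hi; unfold csub. rewrite (proj1 (Hs k)), (proj1 (Hs (S k))) by auto. ring.
      - replace (2 * K * (/ 2) ^ k) with (K * (2 * (/ 2) ^ k)) by ring.
        apply Rmult_le_compat_l; auto.
        eapply Rle_trans; [apply (norm_csub_tri _ (unit_vec e))|].
        rewrite norm_csub_sym. assert (H1 := proj2 (Hs k)). assert (H2 := proj2 (Hs (S k))).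
        simpl in H2. assert (H3 := half_pow_pos k). lra. }
    apply choice in Hlim as [l Hl].
    assert (H0 : N (csub (unit_vec e) l) <= 0).
    { apply le_of_half_pow with (1 + 4 * K * sumR (seq 0 d) (fun j => N (unit_vec j))).
      intros k. eapply Rle_trans; [apply (norm_csub_tri _ (s k))|].
      assert (H1 := proj2 (Hs k)). rewrite (norm_csub_sym (s k)).
      assert (H2 := norm_le_coords (csub l (s k))).
      assert (H3 : sumR (seq 0 d) (fun j => Cmod (csub l (s k) j) * N (unit_vec j))
        <= 4 * K * (/ 2) ^ k * sumR (seq 0 d) (fun j => N (unit_vec j))).
      { rewrite <- sumR_scal. apply sumR_le; intros j _.
        apply Rmult_le_compat_r; [apply norm_ge_0|]. specialize (Hl j k). unfold csub; lra. }
      lra. }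
    (* The limit l equals the unit vector in coordinate e, where it is also a limit of zeros: 1 =
       0. *)
    assert (H1 := norm_eq_0 _ H0 e ltac:(lia)).
    assert (H2 : l e = RtoC 0).
    { apply Cmod_le_eps_0; intros x Hx. destruct (half_pow_small (2 * (2 * K)) x Hx) as [k Hk].
      specialize (Hl e k). rewrite (proj1 (Hs k)) in Hl by lia.
      replace (l e - RtoC 0)%C with (l e) in Hl by ring. lra. }
    unfold csub, unit_vec in H1. rewrite H2, Nat.eqb_refl in H1.
    replace (RtoC 1 - RtoC 0)%C with (RtoC 1) in H1 by ring. apply RtoC_inj in H1; lra. }
  destruct Hdist as (delta & Hdelta & Hdist).
  assert (HU := norm_ge_0 (unit_vec e)).
  assert (Hid : 0 < / delta) by (apply Rinv_0_lt_compat; auto).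
  (* The summand / delta serves coordinate e; the other one serves the coordinates below e, after c
     e times the unit vector is subtracted from c. *)
  exists (K * (1 + N (unit_vec e) * / delta) + / delta); split.
  { assert (0 <= N (unit_vec e) * / delta) by (apply Rmult_le_pos; lra).
    assert (0 <= K * (1 + N (unit_vec e) * / delta)) by (apply Rmult_le_pos; lra). lra. }
  intros c Hc.
  assert (HNc := norm_ge_0 c).
  assert (Htop : Cmod (c e) <= / delta * N c).
  { destruct (Req_dec (Cmod (c e)) 0) as [E|E].
    - rewrite E. apply Rmult_le_pos; lra.
    - assert (Hce : c e <> RtoC 0) by (intros H; apply E; rewrite H; apply Cmod_0).
      (* With this s, c equals c e times (unit_vec e - s), so N c is |c e| times a norm that is at
         least delta. *)
      specialize (Hdist (fun k => if Nat.eqb k e then RtoC 0 else (- c k / c e)%C)).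
      replace (N c) with (Cmod (c e) * N (csub (unit_vec e)
          (fun k => if Nat.eqb k e then RtoC 0 else (- c k / c e)%C))).
      + apply Rmult_le_reg_l with delta; auto.
        rewrite <- Rmult_assoc, Rinv_r, Rmult_1_l, Rmult_comm by lra.
        apply Rmult_le_compat_l; [apply Cmod_ge_0|]. apply Hdist.
        intros k Hk. destruct (Nat.eqb_spec k e); auto. rewrite Hc by lia. field; auto.
      + rewrite <- norm_scal. f_equal. apply functional_extensionality; intros k.
        unfold csub, unit_vec. destruct (Nat.eqb_spec k e) as [->|_]; [ring|field; auto]. }
  intros k. destruct (Nat.eq_dec k e) as [->|Hne].
  - eapply Rle_trans; [exact Htop|]. rewrite Rmult_plus_distr_r.
    assert (0 <= N (unit_vec e) * / delta) by (apply Rmult_le_pos; lra).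
    assert (0 <= K * (1 + N (unit_vec e) * / delta) * N c)
      by (repeat apply Rmult_le_pos; lra). lra.
  - assert (H1 := HKc (csub c (fun j => Cmult (c e) (unit_vec e j)))).
    assert (H2 : Cmod (c k) <= K * N (csub c (fun j => Cmult (c e) (unit_vec e j)))).
    { replace (c k) with (csub c (fun j => Cmult (c e) (unit_vec e j)) k).
      - apply H1. intros j Hj. unfold csub, unit_vec.
        destruct (Nat.eqb_spec j e) as [->|]; [ring|]. rewrite Hc by lia. ring.
      - unfold csub, unit_vec. destruct (Nat.eqb_spec k e); [tauto|ring]. }
    assert (H3 := norm_csub_le c (fun j => Cmult (c e) (unit_vec e j))).
    rewrite norm_scal in H3.
    assert (H4 : Cmod (c e) * N (unit_vec e) <= / delta * N c * N (unit_vec e))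
      by (apply Rmult_le_compat_r; auto).
    eapply Rle_trans; [exact H2|]. rewrite Rmult_plus_distr_r.
    assert (0 <= / delta * N c) by (apply Rmult_le_pos; lra).
    apply Rle_trans with (K * ((1 + N (unit_vec e) * / delta) * N c)); [|lra].
    apply Rmult_le_compat_l; auto. lra.
Qed.

Lemma norm_coords :
  exists K, 0 <= K /\ forall (c : nat -> C) k, (k < d)%nat -> Cmod (c k) <= K * N c.
Proof.
  destruct (norm_coords_supported d (le_n d)) as (K & HK & H). exists K; split; auto.
  intros c k Hk. pose (c' := fun k => if Nat.ltb k d then c k else RtoC 0).
  rewrite (norm_ext c c'); [replace (c k) with (c' k); [apply H|]|].
  - intros j Hj; unfold c'; destruct (Nat.ltb_spec j d); [lia|auto].
  - unfold c'; destruct (Nat.ltb_spec k d); [auto|lia].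
  - intros j Hj; unfold c'; destruct (Nat.ltb_spec j d); [auto|lia].
Qed.

End Norm.

(** * Scalar Hölder spaces *)

Section Interval.

Context (a b : R) (Hab : a < b).

(** Clearing the denominator admits s = t and leaves an expression linear in (f, g), so sums,
    multiples and limits of derivatives reduce to [ring] and the triangle inequality. *)
Lemma is_deriv_inE (f g : R -> C) :
  is_deriv_in a b f g <->
  forall t, a <= t <= b -> forall eps, 0 < eps -> exists delta, 0 < delta /\
    forall s, a <= s <= b -> Rabs (s - t) < delta ->
      Cmod (f s - f t - RtoC (s - t) * g t)%C <= eps * Rabs (s - t).
Proof.
  split; intros H t Ht eps He.
  - destruct (H t Ht eps He) as [d [Hd Hs]]; exists d; split; auto.
    intros s Is Hst. destruct (Req_dec s t) as [->|Hne].
    + replace (f t - f t - RtoC (t - t) * g t)%C with (RtoC 0).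
      rewrite Cmod_0, Rminus_diag, Rabs_R0; lra.
      rewrite Rminus_diag; ring.
    + assert (Hn : RtoC (s - t) <> RtoC 0)
        by (intros E; apply RtoC_inj in E; lra).
      replace (f s - f t - RtoC (s - t) * g t)%C
        with (((f s - f t) / RtoC (s - t) - g t) * RtoC (s - t))%C by (field; auto).
      rewrite Cmod_mult, Cmod_R. apply Rmult_le_compat_r; [apply Rabs_pos|].
      left; apply Hs; auto.
  - destruct (H t Ht (eps / 2) ltac:(lra)) as [d [Hd Hs]]; exists d; split; auto.
    intros s Is Hne Hst.
    assert (Hn : RtoC (s - t) <> RtoC 0)
      by (intros E; apply RtoC_inj in E; lra).
    assert (Hp : 0 < Rabs (s - t)) by (apply Rabs_pos_lt; lra).
    replace (Cminus (Cdiv (Cminus (f s) (f t)) (RtoC (s - t))) (g t))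
      with ((f s - f t - RtoC (s - t) * g t) / RtoC (s - t))%C by (field; auto).
    rewrite Cmod_div, Cmod_R by auto.
    apply Rle_lt_trans with (eps / 2); [|lra].
    apply Rmult_le_reg_r with (Rabs (s - t)); auto.
    unfold Rdiv at 1; rewrite Rmult_assoc, Rinv_l, Rmult_1_r by lra; auto.
Qed.

(** Because a < b, every point of [a,b] is a limit of other points of [a,b], at the ends too;
    without this a derivative within [a,b] would not be unique. *)
Lemma ex_near_point (t d : R) :
  a <= t <= b -> 0 < d -> exists s, a <= s <= b /\ s <> t /\ Rabs (s - t) < d.
Proof.
  intros Ht Hd. destruct (Rlt_dec t b) as [Hlt|Hge].
  - exists (Rmin b (t + d / 2)). unfold Rmin; destruct (Rle_dec b (t + d / 2));
    repeat split; try lra; rewrite Rabs_pos_eq; lra.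
  - exists (Rmax a (t - d / 2)). unfold Rmax; destruct (Rle_dec a (t - d / 2));
    repeat split; try lra; rewrite Rabs_left1; lra.
Qed.

Lemma is_deriv_in_unique (f g h : R -> C) :
  is_deriv_in a b f g -> is_deriv_in a b f h ->
  forall t, a <= t <= b -> g t = h t.
Proof.
  intros Hg Hh t Ht.
  cut ((g t - h t)%C = RtoC 0).
  { intros E. replace (g t) with ((g t - h t) + h t)%C by ring. rewrite E; ring. }
  apply Cmod_le_eps_0; intros e He.
  destruct (proj1 (is_deriv_inE f g) Hg t Ht (e / 2) ltac:(lra)) as [d1 [Hd1 Hs1]].
  destruct (proj1 (is_deriv_inE f h) Hh t Ht (e / 2) ltac:(lra)) as [d2 [Hd2 Hs2]].
  destruct (ex_near_point t (Rmin d1 d2) Ht) as [s [Is [Hne Hst]]]; [apply Rmin_pos; auto|].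
  specialize (Hs1 s Is (Rlt_le_trans _ _ _ Hst (Rmin_l _ _))).
  specialize (Hs2 s Is (Rlt_le_trans _ _ _ Hst (Rmin_r _ _))).
  assert (Hp : 0 < Rabs (s - t)) by (apply Rabs_pos_lt; lra).
  apply Rmult_le_reg_r with (Rabs (s - t)); auto.
  rewrite <- Cmod_R, <- Cmod_mult.
  replace ((g t - h t) * RtoC (s - t))%C
    with ((f s - f t - RtoC (s - t) * h t) - (f s - f t - RtoC (s - t) * g t))%C by ring.
  eapply Rle_trans; [apply Cmod_sub_le|]. rewrite Cmod_R; lra.
Qed.

Lemma is_deriv_in_ext (f f' g g' : R -> C) :
  (forall t, a <= t <= b -> f t = f' t) -> (forall t, a <= t <= b -> g t = g' t) ->
  is_deriv_in a b f g -> is_deriv_in a b f' g'.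
Proof.
  intros Hf Hg H t Ht eps He. destruct (H t Ht eps He) as [d [Hd Hs]].
  exists d; split; auto. intros s Is Hne Hst.
  rewrite <- !Hf, <- Hg; auto.
Qed.

Lemma is_deriv_in_scal (l : C) (f g : R -> C) :
  is_deriv_in a b f g -> is_deriv_in a b (fun t => l * f t)%C (fun t => l * g t)%C.
Proof.
  intros H; apply is_deriv_inE; intros t Ht eps He.
  assert (Hl := Cmod_ge_0 l).
  destruct (proj1 (is_deriv_inE f g) H t Ht (eps / (Cmod l + 1))) as [d [Hd Hs]].
  { apply Rdiv_lt_0_compat; lra. }
  exists d; split; auto. intros s Is Hst.
  replace (l * f s - l * f t - RtoC (s - t) * (l * g t))%C
    with (l * (f s - f t - RtoC (s - t) * g t))%C by ring.
  rewrite Cmod_mult.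
  apply Rle_trans with ((Cmod l + 1) * (eps / (Cmod l + 1) * Rabs (s - t))).
  - apply Rmult_le_compat; auto using Cmod_ge_0; lra.
  - right; field; lra.
Qed.

Lemma is_deriv_in_plus (f1 g1 f2 g2 : R -> C) :
  is_deriv_in a b f1 g1 -> is_deriv_in a b f2 g2 ->
  is_deriv_in a b (fun t => f1 t + f2 t)%C (fun t => g1 t + g2 t)%C.
Proof.
  intros H1 H2; apply is_deriv_inE; intros t Ht eps He.
  destruct (proj1 (is_deriv_inE f1 g1) H1 t Ht (eps / 2) ltac:(lra)) as [d1 [Hd1 Hs1]].
  destruct (proj1 (is_deriv_inE f2 g2) H2 t Ht (eps / 2) ltac:(lra)) as [d2 [Hd2 Hs2]].
  exists (Rmin d1 d2); split; [apply Rmin_pos; auto|]. intros s Is Hst.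
  specialize (Hs1 s Is (Rlt_le_trans _ _ _ Hst (Rmin_l _ _))).
  specialize (Hs2 s Is (Rlt_le_trans _ _ _ Hst (Rmin_r _ _))).
  replace (f1 s + f2 s - (f1 t + f2 t) - RtoC (s - t) * (g1 t + g2 t))%C
    with ((f1 s - f1 t - RtoC (s - t) * g1 t) + (f2 s - f2 t - RtoC (s - t) * g2 t))%C by ring.
  eapply Rle_trans; [apply Cmod_triangle|]. lra.
Qed.

Lemma is_deriv_in_cont (f g : R -> C) : is_deriv_in a b f g -> cont_on a b f.
Proof.
  intros H t Ht eps He.
  destruct (proj1 (is_deriv_inE f g) H t Ht 1 ltac:(lra)) as [d [Hd Hs]].
  assert (Hg := Cmod_ge_0 (g t)).
  exists (Rmin d (eps / (Cmod (g t) + 1))); split.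
  { apply Rmin_pos; auto. apply Rdiv_lt_0_compat; lra. }
  intros s Is Hst.
  specialize (Hs s Is (Rlt_le_trans _ _ _ Hst (Rmin_l _ _))).
  assert (H2 := Rlt_le_trans _ _ _ Hst (Rmin_r _ _)).
  replace (Cminus (f s) (f t)) with ((f s - f t - RtoC (s - t) * g t) + RtoC (s - t) * g t)%C by ring.
  eapply Rle_lt_trans; [apply Cmod_triangle|]. rewrite Cmod_mult, Cmod_R.
  apply Rmult_lt_compat_r with (r := Cmod (g t) + 1) in H2; [|lra].
  replace (eps / (Cmod (g t) + 1) * (Cmod (g t) + 1)) with eps in H2 by (field; lra).
  lra.
Qed.

Lemma is_deriv_in_mult (f1 g1 f2 g2 : R -> C) :
  is_deriv_in a b f1 g1 -> is_deriv_in a b f2 g2 ->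
  is_deriv_in a b (fun t => f1 t * f2 t)%C (fun t => g1 t * f2 t + f1 t * g2 t)%C.
Proof.
  intros H1 H2; apply is_deriv_inE; intros t Ht eps He.
  assert (P1 := Cmod_ge_0 (f1 t)). assert (P2 := Cmod_ge_0 (f2 t)).
  assert (P3 := Cmod_ge_0 (g1 t)).
  (* Each of the three error terms below gets eps / 3; the x + 1 in the denominator allows the
     factor x to vanish. *)
  assert (Q : forall x, 0 <= x -> 0 < eps / (3 * (x + 1))).
  { intros x Hx; apply Rdiv_lt_0_compat; lra. }
  assert (Q' : forall x, 0 <= x -> (x + 1) * (eps / (3 * (x + 1))) = eps / 3).
  { intros x Hx; field; lra. }
  destruct (proj1 (is_deriv_inE f1 g1) H1 t Ht _ (Q _ P2)) as [d1 [Hd1 Hs1]].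
  destruct (proj1 (is_deriv_inE f2 g2) H2 t Ht _ (Q _ P1)) as [d2 [Hd2 Hs2]].
  destruct (is_deriv_in_cont _ _ H2 t Ht 1 ltac:(lra)) as [d3 [Hd3 Hs3]].
  destruct (is_deriv_in_cont _ _ H2 t Ht _ (Q _ P3)) as [d4 [Hd4 Hs4]].
  exists (Rmin (Rmin d1 d2) (Rmin d3 d4)); split; [repeat apply Rmin_pos; auto|].
  intros s Is Hst.
  apply Rmin_Rgt_l in Hst as [Hst12 Hst34].
  apply Rmin_Rgt_l in Hst12 as [Hst1 Hst2]. apply Rmin_Rgt_l in Hst34 as [Hst3 Hst4].
  specialize (Hs1 s Is Hst1). specialize (Hs2 s Is Hst2).
  specialize (Hs3 s Is Hst3). specialize (Hs4 s Is Hst4).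
  specialize (Q' _ P1) as Q1. specialize (Q' _ P2) as Q2. specialize (Q' _ P3) as Q3.
  assert (Pd := Rabs_pos (s - t)).
  assert (Hf2 : Cmod (f2 s) <= Cmod (f2 t) + 1).
  { replace (f2 s) with ((f2 s - f2 t) + f2 t)%C by ring.
    eapply Rle_trans; [apply Cmod_triangle|]. lra. }
  replace (f1 s * f2 s - f1 t * f2 t - RtoC (s - t) * (g1 t * f2 t + f1 t * g2 t))%C
    with (f2 s * (f1 s - f1 t - RtoC (s - t) * g1 t)
          + RtoC (s - t) * (g1 t * (f2 s - f2 t))
          + f1 t * (f2 s - f2 t - RtoC (s - t) * g2 t))%C by ring.
  apply Rle_trans with (eps / 3 * Rabs (s - t) + Rabs (s - t) * (eps / 3) + eps / 3 * Rabs (s - t)); [|lra].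
  eapply Rle_trans; [apply Cmod_triangle|]. apply Rplus_le_compat.
  eapply Rle_trans; [apply Cmod_triangle|]. apply Rplus_le_compat.
  - rewrite Cmod_mult, <- Q2, Rmult_assoc. apply Rmult_le_compat; auto using Cmod_ge_0.
  - rewrite !Cmod_mult, Cmod_R. apply Rmult_le_compat_l; auto.
    rewrite <- Q3. apply Rmult_le_compat; auto using Cmod_ge_0; lra.
  - rewrite Cmod_mult, <- Q1, Rmult_assoc. apply Rmult_le_compat; auto using Cmod_ge_0; lra.
Qed.

(** The 1-Lipschitz retraction of R onto [a,b]. Composition with it extends a function continuous on
    [a,b] to one continuous on R, to which the real extreme and mean value theorems apply. *)
Definition clamp (t : R) : R := Rmax a (Rmin b t).

Lemma clamp_in (t : R) : a <= clamp t <= b.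
Proof.
  unfold clamp; split; [apply Rmax_l|].
  apply Rmax_lub; [lra|apply Rmin_l].
Qed.

Lemma clamp_id (t : R) : a <= t <= b -> clamp t = t.
Proof. intros H; unfold clamp; rewrite Rmin_right, Rmax_right; lra. Qed.

Lemma clamp_lip (s t : R) : Rabs (clamp s - clamp t) <= Rabs (s - t).
Proof.
  unfold clamp, Rmax, Rmin;
  repeat destruct Rle_dec; unfold Rabs; repeat destruct Rcase_abs; lra.
Qed.

Lemma cont_on_clamp (f : R -> C) (h : C -> R) :
  (forall x y, Rabs (h x - h y) <= Cmod (x - y)%C) ->
  cont_on a b f -> forall t, continuity_pt (fun t => h (f (clamp t))) t.
Proof.
  intros Hh Hf t. apply continuity_pt_locally; intros eps.
  destruct (Hf (clamp t) (clamp_in t) eps (cond_pos eps)) as [d [Hd Hs]].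
  exists (mkposreal d Hd); intros s Hst.
  eapply Rle_lt_trans; [apply Hh|]. apply Hs; [apply clamp_in|].
  eapply Rle_lt_trans; [apply clamp_lip|]. exact Hst.
Qed.

Lemma cont_on_bounded (f : R -> C) :
  cont_on a b f -> exists M, forall t, a <= t <= b -> Cmod (f t) <= M.
Proof.
  intros Hf.
  destruct (continuity_ab_maj (fun t => Cmod (f (clamp t))) a b ltac:(lra)) as [x [Hx _]].
  - intros c _. apply cont_on_clamp; auto.
    intros u v. apply Rabs_le; split.
    + assert (H := Cmod_triangle (v - u)%C u).
      replace (v - u + u)%C with v in H by ring. rewrite Cmod_minus_sym; lra.
    + assert (H := Cmod_triangle (u - v)%C v).
      replace (u - v + v)%C with u in H by ring. lra.
  - eexists; intros t Ht. rewrite <- (clamp_id t Ht). apply Hx; auto.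
Qed.

Lemma Re_le_Cmod (x : C) : Re x <= Cmod x.
Proof. eapply Rle_trans; [apply Rle_abs|apply re_le_Cmod]. Qed.

(* The real mean value theorem, applied to [Re (conj w * f)] with [w = f s - f t]. *)
Lemma is_deriv_in_lipschitz (f g : R -> C) (M : R) :
  is_deriv_in a b f g -> (forall t, a <= t <= b -> Cmod (g t) <= M) ->
  forall s t, a <= s <= b -> a <= t <= b -> Cmod (f s - f t)%C <= M * Rabs (s - t).
Proof.
  intros Hd HM.
  assert (main : forall s t, a <= s <= b -> a <= t <= b -> t < s ->
            Cmod (f s - f t)%C <= M * (s - t)).
  { intros s t Is It Hts. set (w := (f s - f t)%C).
    destruct (Req_dec (Cmod w) 0) as [Hw|Hw].
    { rewrite Hw. apply Rmult_le_pos; [|lra].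
      eapply Rle_trans; [apply Cmod_ge_0|apply (HM t It)]. }
    assert (Hw' : 0 < Cmod w) by (assert (H := Cmod_ge_0 w); lra).
    pose (F := fun x => Re (Cconj w * f (clamp x))%C).
    pose (dF := fun x => Re (Cconj w * g x)%C).
    destruct (MVT_gen F t s dF) as [c [Hc E]].
    - rewrite Rmin_left, Rmax_right by lra. intros x Hx.
      apply is_derive_Reals. intros eps He.
      assert (He' : 0 < eps / Cmod w) by (apply Rdiv_lt_0_compat; auto).
      destruct (Hd x ltac:(lra) _ He') as [d [Hdp Hs]].
      (* For such small h the point x + h stays in [a,b], where [clamp] is the identity. *)
      assert (Hp : 0 < Rmin d (Rmin (x - a) (b - x))) by (repeat apply Rmin_pos; lra).
      exists (mkposreal _ Hp); simpl; intros h Hh Hhd.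
      apply Rmin_Rgt_l in Hhd as [Hh1 Hh2].
      apply Rmin_Rgt_l in Hh2 as [Hh2 Hh3].
      apply Rabs_def2 in Hh2. apply Rabs_def2 in Hh3.
      assert (Ih : a <= x + h <= b) by lra.
      specialize (Hs (x + h) Ih ltac:(lra)).
      replace (x + h - x) with h in Hs by ring. specialize (Hs Hh1).
      unfold F, dF. rewrite !clamp_id by lra.
      assert (Hhc : RtoC h <> RtoC 0) by (intros E; apply RtoC_inj in E; lra).
      replace ((Re (Cconj w * f (x + h)) - Re (Cconj w * f x)) / h - Re (Cconj w * g x))
        with (Re (Cmult (Cconj w) (Cminus (Cdiv (Cminus (f (x + h)) (f x)) (RtoC h)) (g x)))).
      + eapply Rle_lt_trans; [apply re_le_Cmod|]. rewrite Cmod_mult, Cmod_conj.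
        apply Rmult_lt_compat_l with (r := Cmod w) in Hs; auto.
        replace (Cmod w * (eps / Cmod w)) with eps in Hs by (field; lra). exact Hs.
      + destruct (f (x + h)), (f x), (g x), w. unfold Re; simpl. field; auto.
    - intros x _. unfold F.
      apply (cont_on_clamp (fun x => Cconj w * f x)%C Re).
      + intros u v. replace (Re u - Re v) with (Re (u - v)%C) by (destruct u, v; reflexivity).
        apply re_le_Cmod.
      + eapply is_deriv_in_cont, is_deriv_in_scal, Hd.
    - rewrite Rmin_left, Rmax_right in Hc by lra.
      unfold F, dF in E. rewrite !clamp_id in E by auto.
      (* The increment of F is |w|^2 and its derivative is at most |w| M, so one factor |w|
         cancels. *)
      assert (E1 : Re (Cconj w * f s)%C - Re (Cconj w * f t)%C = Cmod w * Cmod w).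
      { replace (Cmod w * Cmod w) with (Cmod w ^ 2) by ring. rewrite Cmod2_alt.
        unfold w; destruct (f s), (f t); unfold Re, Im; simpl; ring. }
      apply Rmult_le_reg_l with (Cmod w); auto. rewrite <- E1, E.
      rewrite <- Rmult_assoc. apply Rmult_le_compat_r; [lra|].
      eapply Rle_trans; [apply Re_le_Cmod|]. rewrite Cmod_mult, Cmod_conj.
      apply Rmult_le_compat_l; [lra|]. apply HM; lra. }
  intros s t Is It. destruct (Rtotal_order s t) as [H|[->|H]].
  - rewrite Cmod_minus_sym, Rabs_minus_sym, Rabs_pos_eq by lra. auto.
  - replace (f t - f t)%C with (RtoC 0) by ring.
    rewrite Cmod_0, Rminus_diag, Rabs_R0; lra.
  - rewrite Rabs_pos_eq by lra; auto.
Qed.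

(** * Iterated derivatives *)

Lemma der1_spec (f g : R -> C) :
  is_deriv_in a b f g ->
  is_deriv_in a b f (der1 a b f) /\ forall t, a <= t <= b -> der1 a b f t = g t.
Proof.
  intros H.
  assert (H' : is_deriv_in a b f (der1 a b f))
    by (unfold der1; apply epsilon_spec; exists g; auto).
  split; auto. apply is_deriv_in_unique with f; auto.
Qed.

(** Functions that agree on [a,b] have the same derivatives within [a,b], so [epsilon] receives the
    same predicate and returns the same function, even outside [a,b]. *)
Lemma der1_ext (f g : R -> C) :
  (forall t, a <= t <= b -> f t = g t) -> der1 a b f = der1 a b g.
Proof.
  intros H; unfold der1; f_equal. apply functional_extensionality; intros h.
  apply propositional_extensionality; split; apply is_deriv_in_ext; auto.
  intros t Ht; symmetry; auto.
Qed.

(** [derw] adds derivatives on the outside; inductions on the order need to peel off the first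
    derivative instead. *)
Lemma derw_S (f : R -> C) (j : nat) : derw a b f (S j) = derw a b (der1 a b f) j.
Proof. induction j as [|j IH]; [reflexivity|]. simpl in *; rewrite IH; reflexivity. Qed.

Lemma derw_ext (f g : R -> C) (j : nat) :
  (forall t, a <= t <= b -> f t = g t) ->
  forall t, a <= t <= b -> derw a b f j t = derw a b g j t.
Proof.
  intros H t Ht; destruct j as [|j]; [apply H; auto|].
  rewrite !derw_S, (der1_ext f g); auto.
Qed.

(** * Hölder norms *)

Definition holder_bound (alpha : R) (f : R -> C) (M : R) : Prop :=
  forall t1 t2, a <= t1 < t2 -> t2 <= b ->
    Cmod (f t2 - f t1)%C <= M * Rpower (t2 - t1) alpha.

Context (alpha : R) (Halpha : 0 < alpha <= 1).

Lemma supabs_bounds (f : R -> C) (M : R) :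
  (forall t, a <= t <= b -> Cmod (f t) <= M) ->
  supabs a b f <= M /\ forall t, a <= t <= b -> Cmod (f t) <= supabs a b f.
Proof.
  intros H.
  assert (H' : forall t, a <= t <= b -> Cmod (f t) <= supabs a b f <= M).
  { intros t Ht; apply real_Lub_Rbar_bounds.
    - exists t; auto.
    - intros w [s [Is ->]]; auto. }
  split; [apply (H' a); lra|apply H'].
Qed.

Lemma holsemi_bounds (f : R -> C) (M : R) :
  holder_bound alpha f M ->
  0 <= holsemi a b alpha f <= M /\ holder_bound alpha f (holsemi a b alpha f).
Proof.
  intros H.
  assert (H' : forall t1 t2, a <= t1 < t2 -> t2 <= b ->
    Cmod (f t2 - f t1)%C / Rpower (t2 - t1) alpha <= holsemi a b alpha f <= M).
  { intros t1 t2 H1 H2; apply real_Lub_Rbar_bounds.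
    - exists t1, t2; auto.
    - intros w (s1 & s2 & I1 & I2 & ->).
      assert (P := Rpower_pos (s2 - s1) alpha).
      apply Rmult_le_reg_r with (Rpower (s2 - s1) alpha); auto.
      unfold Rdiv; rewrite Rmult_assoc, Rinv_l, Rmult_1_r by lra. apply H; auto. }
  split; [split|].
  - eapply Rle_trans; [|apply (H' a b); lra].
    apply Rmult_le_pos; [apply Cmod_ge_0|]. left; apply Rinv_0_lt_compat, Rpower_pos.
  - apply (H' a b); lra.
  - intros t1 t2 H1 H2. assert (P := Rpower_pos (t2 - t1) alpha).
    destruct (H' t1 t2 H1 H2) as [H3 _].
    apply Rmult_le_compat_r with (r := Rpower (t2 - t1) alpha) in H3; [|lra].
    unfold Rdiv in H3; rewrite Rmult_assoc, Rinv_l, Rmult_1_r in H3 by lra. exact H3.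
Qed.

Lemma holder_bound_cont (f : R -> C) (M : R) : holder_bound alpha f M -> cont_on a b f.
Proof.
  intros H t Ht eps He.
  assert (P : 0 < eps / (Rabs M + 1)).
  { apply Rdiv_lt_0_compat; auto. assert (Q := Rabs_pos M); lra. }
  (* The solution of delta^alpha = eps / (|M| + 1); M itself may be zero or negative. *)
  exists (Rpower (eps / (Rabs M + 1)) (/ alpha)); split; [apply Rpower_pos|].
  assert (main : forall s1 s2, a <= s1 < s2 -> s2 <= b ->
    s2 - s1 < Rpower (eps / (Rabs M + 1)) (/ alpha) -> Cmod (f s2 - f s1)%C < eps).
  { intros s1 s2 H1 H2 H3. eapply Rle_lt_trans; [apply H; auto|].
    assert (H4 : Rpower (s2 - s1) alpha < eps / (Rabs M + 1)).
    { replace (eps / (Rabs M + 1))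
        with (Rpower (Rpower (eps / (Rabs M + 1)) (/ alpha)) alpha)
        by (rewrite Rpower_mult, Rinv_l, Rpower_1; auto; lra).
      apply Rlt_Rpower_l; lra. }
    assert (Q := Rle_abs M). assert (Q' := Rpower_pos (s2 - s1) alpha).
    assert (Q'' := Rabs_pos M).
    apply Rle_lt_trans with ((Rabs M + 1) * Rpower (s2 - s1) alpha).
    - apply Rmult_le_compat_r; lra.
    - apply Rmult_lt_compat_l with (r := Rabs M + 1) in H4; [|lra].
      replace ((Rabs M + 1) * (eps / (Rabs M + 1))) with eps in H4 by (field; lra). exact H4. }
  intros s Is Hst. destruct (Rtotal_order s t) as [Hlt|[->|Hgt]].
  - rewrite Cmod_minus_sym. apply main; try lra.
    rewrite Rabs_minus_sym, Rabs_pos_eq in Hst; lra.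
  - replace (Cminus (f t) (f t)) with (RtoC 0) by ring. rewrite Cmod_0; auto.
  - apply main; try lra. rewrite Rabs_pos_eq in Hst; lra.
Qed.

Lemma in_Cna_0 (f : R -> C) :
  in_Cna a b 0 alpha f <-> exists M, holder_bound alpha f M.
Proof.
  split.
  - intros (_ & _ & H); exact H.
  - intros [M H]; split; [intros j Hj; lia|split].
    + eapply holder_bound_cont, H.
    + exists M; exact H.
Qed.

(** With [hnorm_S], the recursive description of the space: later facts go by induction on the
    order, the Hölder condition being met only at order 0. *)
Lemma in_Cna_S (n : nat) (f : R -> C) :
  in_Cna a b (S n) alpha f <->
  is_deriv_in a b f (der1 a b f) /\ in_Cna a b n alpha (der1 a b f).
Proof.
  unfold in_Cna. split.
  - intros (H1 & H2 & H3). split; [exact (H1 0%nat ltac:(lia))|].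
    rewrite derw_S in H2, H3. repeat split; auto.
    intros j Hj. specialize (H1 (S j) ltac:(lia)). rewrite (derw_S f j), (derw_S f (S j)) in H1. exact H1.
  - intros (H0 & H1 & H2 & H3). rewrite (derw_S f n). repeat split; auto.
    intros [|j] Hj; [exact H0|]. rewrite (derw_S f j), (derw_S f (S j)). apply H1; lia.
Qed.

Lemma hnorm_0 (f : R -> C) :
  hnorm a b 0 alpha f = supabs a b f + holsemi a b alpha f.
Proof. unfold hnorm, sumR; simpl; ring. Qed.

Lemma hnorm_S (n : nat) (f : R -> C) :
  hnorm a b (S n) alpha f = supabs a b f + hnorm a b n alpha (der1 a b f).
Proof.
  unfold hnorm. rewrite derw_S.
  rewrite sumR_seq_S, Rplus_assoc. do 2 f_equal.
  f_equal. apply functional_extensionality; intros j. rewrite derw_S; reflexivity.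
Qed.

Lemma supabs_ext (f g : R -> C) :
  (forall t, a <= t <= b -> f t = g t) -> supabs a b f = supabs a b g.
Proof.
  intros H; unfold supabs; do 2 f_equal. apply functional_extensionality; intros v.
  apply propositional_extensionality; split; intros [t [Ht ->]]; exists t; split; auto;
  rewrite H; auto.
Qed.

Lemma holsemi_ext (f g : R -> C) :
  (forall t, a <= t <= b -> f t = g t) -> holsemi a b alpha f = holsemi a b alpha g.
Proof.
  intros H; unfold holsemi; do 2 f_equal. apply functional_extensionality; intros v.
  apply propositional_extensionality; split; intros (t1 & t2 & H1 & H2 & ->);
  exists t1, t2; repeat split; try tauto; rewrite !H; auto; lra.
Qed.

Lemma hnorm_ext (n : nat) (f g : R -> C) :
  (forall t, a <= t <= b -> f t = g t) -> hnorm a b n alpha f = hnorm a b n alpha g.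
Proof.
  intros H; destruct n as [|n].
  - rewrite !hnorm_0, (supabs_ext f g), (holsemi_ext f g); auto.
  - rewrite !hnorm_S, (supabs_ext f g), (der1_ext f g); auto.
Qed.

Lemma in_Cna_ext (n : nat) (f g : R -> C) :
  (forall t, a <= t <= b -> f t = g t) -> in_Cna a b n alpha f -> in_Cna a b n alpha g.
Proof.
  intros H; destruct n as [|n].
  - rewrite !in_Cna_0. intros [M HM]; exists M; intros t1 t2 H1 H2.
    rewrite <- !H by lra; auto.
  - rewrite !in_Cna_S, (der1_ext f g) by auto. intros [H1 H2]; split; auto.
    apply is_deriv_in_ext with f (der1 a b g); auto.
Qed.

(** Lets an explicit derivative g, such as one given by the product rule, replace the one chosen by
    [der1]. *)
Lemma in_Cna_deriv (n : nat) (f g : R -> C) :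
  is_deriv_in a b f g -> in_Cna a b n alpha g ->
  in_Cna a b (S n) alpha f /\ hnorm a b (S n) alpha f = supabs a b f + hnorm a b n alpha g.
Proof.
  intros H1 H2. destruct (der1_spec f g H1) as [H3 H4]. split.
  - apply in_Cna_S; split; auto. apply in_Cna_ext with g; auto.
    intros t Ht; symmetry; auto.
  - rewrite hnorm_S, (hnorm_ext n (der1 a b f) g); auto.
Qed.

Lemma in_Cna_bounded (n : nat) (f : R -> C) :
  in_Cna a b n alpha f -> forall t, a <= t <= b -> Cmod (f t) <= supabs a b f.
Proof.
  intros H. assert (Hc : cont_on a b f).
  { destruct n as [|n]; [apply H|]. apply in_Cna_S in H.
    eapply is_deriv_in_cont, (proj1 H). }
  destruct (cont_on_bounded f Hc) as [M HM]. apply (supabs_bounds f M HM).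
Qed.

Lemma supabs_ge_0 (n : nat) (f : R -> C) : in_Cna a b n alpha f -> 0 <= supabs a b f.
Proof.
  intros H. eapply Rle_trans; [apply Cmod_ge_0|apply (in_Cna_bounded n f H a)]. lra.
Qed.

Lemma holsemi_spec (f : R -> C) :
  in_Cna a b 0 alpha f ->
  0 <= holsemi a b alpha f /\ holder_bound alpha f (holsemi a b alpha f).
Proof.
  intros H; apply in_Cna_0 in H as [M HM].
  destruct (holsemi_bounds f M HM) as [[H1 _] H2]; auto.
Qed.

Lemma hnorm_ge_0 (n : nat) (f : R -> C) : in_Cna a b n alpha f -> 0 <= hnorm a b n alpha f.
Proof.
  revert f; induction n as [|n IH]; intros f H; assert (Hs := supabs_ge_0 _ _ H).
  - rewrite hnorm_0. apply holsemi_spec in H; lra.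
  - rewrite hnorm_S. apply in_Cna_S in H as [_ H]. specialize (IH _ H); lra.
Qed.

Lemma supabs_le_hnorm (n : nat) (f : R -> C) :
  in_Cna a b n alpha f -> supabs a b f <= hnorm a b n alpha f.
Proof.
  destruct n as [|n]; intros H.
  - rewrite hnorm_0. apply holsemi_spec in H; lra.
  - rewrite hnorm_S. apply in_Cna_S in H as [_ H]. apply hnorm_ge_0 in H; lra.
Qed.

Lemma Cmod_le_hnorm (n : nat) (f : R -> C) (t : R) :
  in_Cna a b n alpha f -> a <= t <= b -> Cmod (f t) <= hnorm a b n alpha f.
Proof.
  intros H Ht. eapply Rle_trans; [|apply supabs_le_hnorm, H].
  eapply in_Cna_bounded; eauto.
Qed.

Lemma supabs_le (f : R -> C) (M : R) :
  (forall t, a <= t <= b -> Cmod (f t) <= M) -> supabs a b f <= M.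
Proof. intros H; apply supabs_bounds, H. Qed.

Lemma in_Cna_0_intro (f : R -> C) (M1 M2 : R) :
  (forall t, a <= t <= b -> Cmod (f t) <= M1) -> holder_bound alpha f M2 ->
  in_Cna a b 0 alpha f /\ hnorm a b 0 alpha f <= M1 + M2.
Proof.
  intros H1 H2; split; [apply in_Cna_0; exists M2; auto|].
  rewrite hnorm_0. apply Rplus_le_compat; [apply supabs_le; auto|].
  apply holsemi_bounds, H2.
Qed.

Lemma in_Cna_plus (n : nat) (f g : R -> C) :
  in_Cna a b n alpha f -> in_Cna a b n alpha g ->
  in_Cna a b n alpha (fun t => f t + g t)%C /\
  hnorm a b n alpha (fun t => f t + g t)%C <= hnorm a b n alpha f + hnorm a b n alpha g.
Proof.
  revert f g; induction n as [|n IH]; intros f g Hf Hg;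
  assert (Bf := in_Cna_bounded _ _ Hf); assert (Bg := in_Cna_bounded _ _ Hg);
  assert (B : forall t, a <= t <= b -> Cmod (f t + g t)%C <= supabs a b f + supabs a b g)
    by (intros t Ht; eapply Rle_trans; [apply Cmod_triangle|]; apply Rplus_le_compat; auto).
  - rewrite (hnorm_0 f), (hnorm_0 g).
    destruct (holsemi_spec f Hf) as [_ H1]. destruct (holsemi_spec g Hg) as [_ H2].
    destruct (in_Cna_0_intro _ _ (holsemi a b alpha f + holsemi a b alpha g) B) as [H3 H4].
    + intros t1 t2 I1 I2.
      replace (f t2 + g t2 - (f t1 + g t1))%C with ((f t2 - f t1) + (g t2 - g t1))%C by ring.
      eapply Rle_trans; [apply Cmod_triangle|].
      rewrite Rmult_plus_distr_r; apply Rplus_le_compat; auto.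
    + split; auto. lra.
  - rewrite (hnorm_S n f), (hnorm_S n g).
    apply in_Cna_S in Hf as [Df Hf]. apply in_Cna_S in Hg as [Dg Hg].
    destruct (IH _ _ Hf Hg) as [H1 H2].
    destruct (in_Cna_deriv n _ _ (is_deriv_in_plus _ _ _ _ Df Dg) H1) as [H3 H4].
    split; auto. rewrite H4. apply supabs_le in B; lra.
Qed.

Lemma in_Cna_scal (n : nat) (l : C) (f : R -> C) :
  in_Cna a b n alpha f ->
  in_Cna a b n alpha (fun t => l * f t)%C /\
  hnorm a b n alpha (fun t => l * f t)%C <= Cmod l * hnorm a b n alpha f.
Proof.
  revert f; induction n as [|n IH]; intros f Hf;
  assert (Bf := in_Cna_bounded _ _ Hf); assert (Pl := Cmod_ge_0 l);
  assert (B : forall t, a <= t <= b -> Cmod (l * f t)%C <= Cmod l * supabs a b f)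
    by (intros t Ht; rewrite Cmod_mult; apply Rmult_le_compat_l; auto).
  - rewrite (hnorm_0 f).
    destruct (holsemi_spec f Hf) as [_ H1].
    destruct (in_Cna_0_intro _ _ (Cmod l * holsemi a b alpha f) B) as [H3 H4].
    + intros t1 t2 I1 I2.
      replace (l * f t2 - l * f t1)%C with (l * (f t2 - f t1))%C by ring.
      rewrite Cmod_mult, Rmult_assoc; apply Rmult_le_compat_l; auto.
    + split; auto. lra.
  - rewrite (hnorm_S n f).
    apply in_Cna_S in Hf as [Df Hf].
    destruct (IH _ Hf) as [H1 H2].
    destruct (in_Cna_deriv n _ _ (is_deriv_in_scal l _ _ Df) H1) as [H3 H4].
    split; auto. rewrite H4. apply supabs_le in B; lra.
Qed.

Lemma in_Cna_minus (n : nat) (f g : R -> C) :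
  in_Cna a b n alpha f -> in_Cna a b n alpha g ->
  in_Cna a b n alpha (fun t => f t - g t)%C /\
  hnorm a b n alpha (fun t => f t - g t)%C <= hnorm a b n alpha f + hnorm a b n alpha g.
Proof.
  intros Hf Hg. destruct (in_Cna_scal n (RtoC (-1)) g Hg) as [H1 H2].
  destruct (in_Cna_plus n _ _ Hf H1) as [H3 H4].
  replace (fun t => f t - g t)%C with (fun t => f t + RtoC (-1) * g t)%C
    by (apply functional_extensionality; intros t; ring).
  split; auto. rewrite Cmod_R, Rabs_left in H2 by lra. lra.
Qed.

Lemma in_Cna_zero (n : nat) :
  in_Cna a b n alpha (fun _ => RtoC 0) /\ hnorm a b n alpha (fun _ => RtoC 0) = 0.
Proof.
  assert (H : in_Cna a b n alpha (fun _ => RtoC 0)).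
  { induction n as [|n IH].
    - apply in_Cna_0; exists 0; intros t1 t2 _ _.
      replace (RtoC 0 - RtoC 0)%C with (RtoC 0) by ring. rewrite Cmod_0; lra.
    - apply (in_Cna_deriv n) with (fun _ => RtoC 0); auto.
      apply is_deriv_in_ext with (fun t => RtoC 0 * der1 a b (fun _ => RtoC 0) t)%C
                                 (fun t => RtoC 0 * RtoC 0)%C; try (intros; ring).
      apply is_deriv_inE. intros t Ht e He. exists 1; split; [lra|].
      intros s Is _. replace (_ - _ - _)%C with (RtoC 0) by ring.
      rewrite Cmod_0. apply Rmult_le_pos; [lra|apply Rabs_pos]. }
  split; auto. apply Rle_antisym; [|apply hnorm_ge_0; auto].
  (* The zero function is 0 times itself, and scaling by 0 bounds its norm by 0. *)
  destruct (in_Cna_scal n (RtoC 0) _ H) as [_ H1]. rewrite Cmod_0, Rmult_0_l in H1.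
  replace (fun _ => RtoC 0) with (fun t : R => RtoC 0 * RtoC 0)%C; auto.
  apply functional_extensionality; intros; ring.
Qed.

(** Bounds the embedding that lowers the order by one. By the mean value inequality a function has
    Hölder constant at most sup |f'| times (b - a)^(1 - alpha), since t = t^(1 - alpha) t^alpha and
    1 - alpha is nonnegative. *)
Definition emb_const : R := 1 + Rpower (b - a) (1 - alpha).

Lemma emb_const_ge_1 : 1 <= emb_const.
Proof. unfold emb_const; assert (H := Rpower_pos (b - a) (1 - alpha)); lra. Qed.

Lemma in_Cna_pred (n : nat) (f : R -> C) :
  in_Cna a b (S n) alpha f ->
  in_Cna a b n alpha f /\ hnorm a b n alpha f <= emb_const * hnorm a b (S n) alpha f.
Proof.
  revert f; induction n as [|n IH]; intros f Hf;
  assert (Bf := in_Cna_bounded _ _ Hf); assert (Ps := supabs_ge_0 _ _ Hf);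
  apply in_Cna_S in Hf as [Df Hf]; assert (K := emb_const_ge_1);
  assert (Pn := hnorm_ge_0 _ _ Hf).
  - rewrite (hnorm_S 0 f). set (g := der1 a b f) in *.
    assert (Bg := in_Cna_bounded _ _ Hf). assert (Psg := supabs_ge_0 _ _ Hf).
    destruct (in_Cna_0_intro f (supabs a b f) (supabs a b g * Rpower (b - a) (1 - alpha)) Bf) as [H1 H2].
    + intros t1 t2 I1 I2.
      eapply Rle_trans; [apply (is_deriv_in_lipschitz _ _ _ Df Bg); lra|].
      rewrite Rabs_pos_eq, Rmult_assoc by lra. apply Rmult_le_compat_l; auto.
      rewrite <- (Rpower_1 (t2 - t1)) at 1 by lra.
      replace 1 with ((1 - alpha) + alpha) at 1 by ring. rewrite Rpower_plus.
      apply Rmult_le_compat_r; [left; apply Rpower_pos|].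
      apply Rle_Rpower_l; lra.
    + split; auto. eapply Rle_trans; [exact H2|].
      assert (Hg := supabs_le_hnorm _ _ Hf).
      apply Rle_trans with (1 * supabs a b f + (emb_const - 1) * hnorm a b 0 alpha g).
      * unfold emb_const. assert (Q := Rpower_pos (b - a) (1 - alpha)).
        assert (supabs a b g * Rpower (b - a) (1 - alpha)
                <= hnorm a b 0 alpha g * Rpower (b - a) (1 - alpha))
          by (apply Rmult_le_compat_r; lra). lra.
      * assert (1 * supabs a b f <= emb_const * supabs a b f)
          by (apply Rmult_le_compat_r; lra). lra.
  - rewrite (hnorm_S (S n) f). destruct (IH _ Hf) as [H1 H2].
    destruct (in_Cna_deriv n _ _ Df H1) as [H3 H4]. split; auto. rewrite H4.
    assert (1 * supabs a b f <= emb_const * supabs a b f)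
      by (apply Rmult_le_compat_r; lra). lra.
Qed.

Lemma in_Cna_weaken (n k : nat) (f : R -> C) :
  in_Cna a b (n + k) alpha f ->
  in_Cna a b n alpha f /\ hnorm a b n alpha f <= emb_const ^ k * hnorm a b (n + k) alpha f.
Proof.
  induction k as [|k IH].
  - rewrite Nat.add_0_r, pow_O; intros H; split; auto; lra.
  - rewrite Nat.add_succ_r. intros H. destruct (in_Cna_pred _ _ H) as [H1 H2].
    destruct (IH H1) as [H3 H4]. split; auto. assert (K := emb_const_ge_1).
    simpl. rewrite (Rmult_comm emb_const), Rmult_assoc.
    eapply Rle_trans; [exact H4|]. apply Rmult_le_compat_l; auto.
    apply pow_le; lra.
Qed.

Lemma in_Cna_derw (n j : nat) (f : R -> C) :
  in_Cna a b (n + j) alpha f ->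
  in_Cna a b n alpha (derw a b f j) /\
  hnorm a b n alpha (derw a b f j) <= hnorm a b (n + j) alpha f.
Proof.
  revert f; induction j as [|j IH]; intros f.
  - rewrite Nat.add_0_r; simpl; split; auto; lra.
  - rewrite Nat.add_succ_r, derw_S, hnorm_S. intros H.
    assert (Ps := supabs_ge_0 _ _ H). apply in_Cna_S in H as [_ H].
    destruct (IH _ H) as [H1 H2]. split; auto; lra.
Qed.

Lemma in_Cna_derw_le (n r j : nat) (f : R -> C) :
  (j <= r)%nat -> in_Cna a b (n + r) alpha f ->
  in_Cna a b n alpha (derw a b f j) /\
  hnorm a b n alpha (derw a b f j) <= emb_const ^ r * hnorm a b (n + r) alpha f.
Proof.
  intros Hj H. assert (Pn := hnorm_ge_0 _ _ H).
  replace (n + r)%nat with (n + j + (r - j))%nat in H, Pn |- * by lia.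
  destruct (in_Cna_weaken _ _ _ H) as [H1 H2]. destruct (in_Cna_derw _ _ _ H1) as [H3 H4].
  split; auto. eapply Rle_trans; [exact H4|]. eapply Rle_trans; [exact H2|].
  apply Rmult_le_compat_r; auto. apply Rle_pow; [apply emb_const_ge_1|lia].
Qed.

Lemma derw_plus (n j : nat) (f g : R -> C) :
  (j <= n)%nat -> in_Cna a b n alpha f -> in_Cna a b n alpha g ->
  forall t, a <= t <= b ->
  derw a b (fun t => f t + g t)%C j t = (derw a b f j t + derw a b g j t)%C.
Proof.
  revert n f g; induction j as [|j IH]; intros n f g Hj Hf Hg t Ht; [reflexivity|].
  destruct n as [|n]; [lia|].
  apply in_Cna_S in Hf as [Df Hf]. apply in_Cna_S in Hg as [Dg Hg].
  rewrite !derw_S, <- (IH n) by (auto; lia). apply derw_ext; auto.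
  apply (der1_spec _ _ (is_deriv_in_plus _ _ _ _ Df Dg)).
Qed.

Lemma derw_scal (n j : nat) (l : C) (f : R -> C) :
  (j <= n)%nat -> in_Cna a b n alpha f ->
  forall t, a <= t <= b -> derw a b (fun t => l * f t)%C j t = (l * derw a b f j t)%C.
Proof.
  revert n f; induction j as [|j IH]; intros n f Hj Hf t Ht; [reflexivity|].
  destruct n as [|n]; [lia|]. apply in_Cna_S in Hf as [Df Hf].
  rewrite !derw_S, <- (IH n) by (auto; lia). apply derw_ext; auto.
  apply (der1_spec _ _ (is_deriv_in_scal l _ _ Df)).
Qed.

(** Only the first-order product rule is needed: in f' g + f g' the undifferentiated factor is
    lowered to order n by the embedding, and the induction hypothesis handles both products. *)
Lemma in_Cna_mult (n : nat) :
  exists K, 0 <= K /\ forall f g : R -> C,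
  in_Cna a b n alpha f -> in_Cna a b n alpha g ->
  in_Cna a b n alpha (fun t => f t * g t)%C /\
  hnorm a b n alpha (fun t => f t * g t)%C <= K * (hnorm a b n alpha f * hnorm a b n alpha g).
Proof.
  induction n as [|n [K [HK IH]]].
  - exists 1; split; [lra|]. intros f g Hf Hg.
    assert (Bf := in_Cna_bounded _ _ Hf); assert (Bg := in_Cna_bounded _ _ Hg).
    assert (Pf := supabs_ge_0 _ _ Hf); assert (Pg := supabs_ge_0 _ _ Hg).
    rewrite (hnorm_0 f), (hnorm_0 g).
    destruct (holsemi_spec f Hf) as [Qf H1]. destruct (holsemi_spec g Hg) as [Qg H2].
    set (sf := supabs a b f) in *. set (sg := supabs a b g) in *.
    set (hf := holsemi a b alpha f) in *. set (hg := holsemi a b alpha g) in *.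
    destruct (in_Cna_0_intro (fun t => f t * g t)%C (sf * sg) (hf * sg + sf * hg)) as [H3 H4].
    + intros t Ht; rewrite Cmod_mult; apply Rmult_le_compat; auto using Cmod_ge_0.
    + intros t1 t2 I1 I2.
      replace (f t2 * g t2 - f t1 * g t1)%C
        with ((f t2 - f t1) * g t2 + f t1 * (g t2 - g t1))%C by ring.
      eapply Rle_trans; [apply Cmod_triangle|]. rewrite !Cmod_mult.
      set (p := Rpower (t2 - t1) alpha) in *.
      replace ((hf * sg + sf * hg) * p) with (hf * p * sg + sf * (hg * p)) by ring.
      apply Rplus_le_compat; apply Rmult_le_compat; try apply Cmod_ge_0; auto;
      try (apply Bf || apply Bg; lra).
    + split; auto. assert (0 <= hf * hg) by (apply Rmult_le_pos; auto). lra.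
  - exists (1 + 2 * K * emb_const); split.
    { assert (E := emb_const_ge_1). assert (0 <= K * emb_const) by (apply Rmult_le_pos; lra). lra. }
    intros f g Hf Hg.
    assert (Bf := in_Cna_bounded _ _ Hf); assert (Bg := in_Cna_bounded _ _ Hg).
    assert (Pf := supabs_ge_0 _ _ Hf); assert (Pg := supabs_ge_0 _ _ Hg).
    destruct (in_Cna_pred _ _ Hf) as [Lf Ef]. destruct (in_Cna_pred _ _ Hg) as [Lg Eg].
    assert (Nf := supabs_le_hnorm _ _ Hf). assert (Ng := supabs_le_hnorm _ _ Hg).
    assert (Mf := hnorm_S n f). assert (Mg := hnorm_S n g).
    apply in_Cna_S in Hf as [Df Hf]. apply in_Cna_S in Hg as [Dg Hg].
    assert (Qf := hnorm_ge_0 _ _ Hf). assert (Qg := hnorm_ge_0 _ _ Hg).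
    assert (Rf := hnorm_ge_0 _ _ Lf). assert (Rg := hnorm_ge_0 _ _ Lg).
    destruct (IH _ _ Hf Lg) as [H1 H2]. destruct (IH _ _ Lf Hg) as [H3 H4].
    destruct (in_Cna_plus _ _ _ H1 H3) as [H5 H6].
    destruct (in_Cna_deriv n _ _ (is_deriv_in_mult _ _ _ _ Df Dg) H5) as [H7 H8].
    split; auto. rewrite H8.
    set (X := hnorm a b (S n) alpha f) in *. set (Y := hnorm a b (S n) alpha g) in *.
    assert (B : supabs a b (fun t => f t * g t)%C <= X * Y).
    { apply supabs_le. intros t Ht; rewrite Cmod_mult.
      apply Rmult_le_compat; auto using Cmod_ge_0;
      eapply Rle_trans; [apply Bf| |apply Bg|]; auto. }
    assert (T : forall u v w z, 0 <= u -> 0 <= v -> u <= w -> v <= emb_const * z ->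
              K * (u * v) <= K * emb_const * (w * z)).
    { intros u v w z Hu Hv Huw Hvz. replace (K * emb_const * (w * z)) with (K * (w * (emb_const * z))) by ring.
      apply Rmult_le_compat_l; auto. apply Rmult_le_compat; auto. }
    assert (T1 := T (hnorm a b n alpha (der1 a b f)) (hnorm a b n alpha g) X Y Qf Rg ltac:(lra) Eg).
    assert (T2 := T (hnorm a b n alpha (der1 a b g)) (hnorm a b n alpha f) Y X Qg Rf ltac:(lra) Ef).
    rewrite (Rmult_comm (hnorm a b n alpha f)) in H4. rewrite (Rmult_comm Y X) in T2.
    lra.
Qed.

(** The pointwise limit x inherits the bounds of the increments. At order 0 these are Hölder bounds.
    At higher order the induction hypothesis gives a limit g of the derivatives, and Lipschitz
    bounds of the increments make the difference quotients converge uniformly, so x' = g. *)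
Lemma in_Cna_complete (n : nat) (u : nat -> R -> C) (c : R) :
  (forall k, in_Cna a b n alpha (u k)) ->
  (forall k, hnorm a b n alpha (fun t => u (S k) t - u k t)%C <= c * (/ 2) ^ k) ->
  exists x D, in_Cna a b n alpha x /\
    forall k, hnorm a b n alpha (fun t => x t - u k t)%C <= D * (/ 2) ^ k.
Proof.
  revert u; induction n as [|n IH]; intros u Hu Hc;
  assert (Hm : forall k, in_Cna a b _ alpha (fun t => u (S k) t - u k t)%C)
    by (intros k; apply in_Cna_minus; auto);
  assert (Hp : forall k t, a <= t <= b -> Cmod (u (S k) t - u k t)%C <= c * (/ 2) ^ k)
    by (intros k t Ht; eapply Rle_trans; [apply (Cmod_le_hnorm _ _ _ (Hm k) Ht)|apply Hc]);
  (* The limit is chosen point by point; it is specified on [a,b] only. *)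
  pose (x := fun t => epsilon (inhabits (RtoC 0))
               (fun l => forall k, Cmod (l - u k t)%C <= 2 * c * (/ 2) ^ k));
  assert (Hx : forall t, a <= t <= b -> forall k, Cmod (x t - u k t)%C <= 2 * c * (/ 2) ^ k)
    by (intros t Ht; unfold x; apply epsilon_spec, geometric_cv; intros k; apply Hp; auto);
  clearbody x; exists x.
  - exists (2 * c + 2 * c).
    assert (Hhol : forall k, holder_bound alpha (fun t => x t - u k t)%C (2 * c * (/ 2) ^ k)).
    { intros k t1 t2 I1 I2. set (p := Rpower (t2 - t1) alpha).
      replace (x t2 - u k t2 - (x t1 - u k t1))%C
        with (x t2 - x t1 - (u k t2 - u k t1))%C by ring.
      replace (2 * c * (/ 2) ^ k * p) with (2 * (c * p) * (/ 2) ^ k) by ring.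
      apply (geometric_limit_bound (fun k => u k t2 - u k t1)%C) with (4 * c); clear k; intros k.
      - destruct (holsemi_spec _ (Hm k)) as [_ Hh]. specialize (Hh t1 t2 I1 I2).
        replace (u (S k) t2 - u (S k) t1 - (u k t2 - u k t1))%C
          with (u (S k) t2 - u k t2 - (u (S k) t1 - u k t1))%C by ring.
        eapply Rle_trans; [exact Hh|].
        replace (c * p * (/ 2) ^ k) with (c * (/ 2) ^ k * p) by ring.
        apply Rmult_le_compat_r; [left; apply Rpower_pos|].
        specialize (Hc k). rewrite hnorm_0 in Hc.
        assert (P := supabs_ge_0 _ _ (Hm k)). lra.
      - replace (x t2 - x t1 - (u k t2 - u k t1))%C
          with ((x t2 - u k t2) - (x t1 - u k t1))%C by ring.
        eapply Rle_trans; [apply Cmod_sub_le|].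
        assert (H1 := Hx t1 ltac:(lra) k). assert (H2 := Hx t2 ltac:(lra) k). lra. }
    assert (Hx0 : forall k, in_Cna a b 0 alpha (fun t => x t - u k t)%C /\
              hnorm a b 0 alpha (fun t => x t - u k t)%C <= (2 * c + 2 * c) * (/ 2) ^ k).
    { intros k. rewrite Rmult_plus_distr_r. apply in_Cna_0_intro; auto. }
    split; [|apply Hx0].
    apply in_Cna_ext with (fun t => (x t - u 0%nat t) + u 0%nat t)%C; [intros; ring|].
    apply in_Cna_plus; [apply Hx0|auto].
  - set (v := fun k => der1 a b (u k)).
    assert (Hd : forall k, is_deriv_in a b (u k) (v k)) by (intros k; apply (in_Cna_S n), Hu).
    assert (Hv : forall k, in_Cna a b n alpha (v k)) by (intros k; apply (in_Cna_S n), Hu).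
    assert (Hmd : forall f g f' g', is_deriv_in a b f f' -> is_deriv_in a b g g' ->
              is_deriv_in a b (fun t => f t - g t)%C (fun t => f' t - g' t)%C).
    { intros f g f' g' Hf Hg.
      apply is_deriv_in_ext with (fun t => f t + RtoC (-1) * g t)%C (fun t => f' t + RtoC (-1) * g' t)%C;
        try (intros; ring).
      apply is_deriv_in_plus, is_deriv_in_scal; auto. }
    assert (Hvm : forall k, in_Cna a b n alpha (fun t => v (S k) t - v k t)%C)
      by (intros k; apply in_Cna_minus; auto).
    assert (Hvc : forall k, hnorm a b n alpha (fun t => v (S k) t - v k t)%C <= c * (/ 2) ^ k).
    { intros k.
      destruct (in_Cna_deriv n _ _ (Hmd _ _ _ _ (Hd (S k)) (Hd k)) (Hvm k)) as [_ E].
      specialize (Hc k). rewrite E in Hc. assert (P := supabs_ge_0 _ _ (Hm k)). lra. }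
    destruct (IH v Hv Hvc) as (g & D & Hg & HD).
    assert (Hgm : forall k, in_Cna a b n alpha (fun t => g t - v k t)%C)
      by (intros k; apply in_Cna_minus; auto).
    assert (Hdx : is_deriv_in a b x g).
    { apply is_deriv_inE. intros t Ht e He.
      destruct (half_pow_small (2 * c + D) (e / 2) ltac:(lra)) as [k Hk].
      destruct (proj1 (is_deriv_inE _ _) (Hd k) t Ht (e / 2) ltac:(lra)) as [d [Hdp Hs]].
      exists d; split; auto. intros s Is Hst. specialize (Hs s Is Hst).
      replace (x s - x t - RtoC (s - t) * g t)%C with
        ((x s - x t - (u k s - u k t)) + (u k s - u k t - RtoC (s - t) * v k t)
         - RtoC (s - t) * (g t - v k t))%C by ring.
      eapply Rle_trans; [apply Cmod_sub_le|]. rewrite Cmod_mult, Cmod_R.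
      assert (P := Rabs_pos (s - t)).
      (* For fixed s and t the mean value inequality bounds the increments of u k s - u k t by a
         multiple of |s - t|, and [geometric_limit_bound] keeps that factor in the limit. *)
      assert (T1 : Cmod (x s - x t - (u k s - u k t))%C <= 2 * (c * Rabs (s - t)) * (/ 2) ^ k).
      { apply (geometric_limit_bound (fun k => u k s - u k t)%C) with (4 * c); intros i.
        - replace (u (S i) s - u (S i) t - (u i s - u i t))%C
            with ((u (S i) s - u i s) - (u (S i) t - u i t))%C by ring.
          replace (c * Rabs (s - t) * (/ 2) ^ i) with (c * (/ 2) ^ i * Rabs (s - t)) by ring.
          apply (is_deriv_in_lipschitz _ _ _ (Hmd _ _ _ _ (Hd (S i)) (Hd i))); auto.
          intros t' Ht'. eapply Rle_trans; [apply (Cmod_le_hnorm _ _ _ (Hvm i) Ht')|apply Hvc].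
        - replace (x s - x t - (u i s - u i t))%C
            with ((x s - u i s) - (x t - u i t))%C by ring.
          eapply Rle_trans; [apply Cmod_sub_le|].
          assert (H1 := Hx t Ht i). assert (H2 := Hx s Is i). lra. }
      assert (T3 : Cmod (g t - v k t)%C <= D * (/ 2) ^ k)
        by (eapply Rle_trans; [apply (Cmod_le_hnorm _ _ _ (Hgm k) Ht)|apply HD]).
      assert (T4 : Rabs (s - t) * Cmod (g t - v k t)%C <= Rabs (s - t) * (D * (/ 2) ^ k))
        by (apply Rmult_le_compat_l; auto).
      assert (T5 : (2 * c + D) * (/ 2) ^ k * Rabs (s - t) <= e / 2 * Rabs (s - t))
        by (apply Rmult_le_compat_r; lra).
      eapply Rle_trans; [apply Rplus_le_compat_r, Cmod_triangle|]. lra. }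
    exists (2 * c + D). split; [apply (in_Cna_deriv n x g); auto|].
    intros k. destruct (in_Cna_deriv n _ _ (Hmd _ _ _ _ Hdx (Hd k)) (Hgm k)) as [_ E].
    rewrite E. specialize (HD k).
    assert (supabs a b (fun t => x t - u k t)%C <= 2 * c * (/ 2) ^ k)
      by (apply supabs_le; intros t Ht; apply Hx; auto).
    lra.
Qed.

(** * The differential operator on vector functions *)

Lemma in_Cna_sumC (n : nat) (l : list nat) (F : nat -> R -> C) :
  (forall i, In i l -> in_Cna a b n alpha (F i)) ->
  in_Cna a b n alpha (fun t => sumC l (fun i => F i t)) /\
  hnorm a b n alpha (fun t => sumC l (fun i => F i t)) <= sumR l (fun i => hnorm a b n alpha (F i)).
Proof.
  induction l as [|i l IH]; intros H; simpl.
  - destruct (in_Cna_zero n) as [H1 H2]; split; auto; lra.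
  - destruct (IH (fun k Hk => H k (or_intror Hk))) as [H1 H2].
    destruct (in_Cna_plus n _ _ (H i (or_introl eq_refl)) H1) as [H3 H4].
    split; auto. eapply Rle_trans; [exact H4|]. apply Rplus_le_compat_l; auto.
Qed.

Context (m : nat).

Definition veq (y z : vfun) : Prop :=
  forall i t, (i < m)%nat -> a <= t <= b -> y i t = z i t.

Lemma vnorm_ext (n : nat) (y z : vfun) :
  veq y z -> vnorm a b m n alpha y = vnorm a b m n alpha z.
Proof. intros H. apply sumR_ext; intros i Hi; apply in_seq0 in Hi. apply hnorm_ext; auto. Qed.

Lemma vin_plus (n : nat) (y z : vfun) :
  vin_Cna a b m n alpha y -> vin_Cna a b m n alpha z ->
  vin_Cna a b m n alpha (vadd y z) /\
  vnorm a b m n alpha (vadd y z) <= vnorm a b m n alpha y + vnorm a b m n alpha z.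
Proof.
  intros Hy Hz; split.
  - intros i Hi; apply in_Cna_plus; auto.
  - unfold vnorm. rewrite <- sumR_plus. apply sumR_le; intros i Hi; apply in_seq0 in Hi.
    apply in_Cna_plus; auto.
Qed.

Lemma vin_scal (n : nat) (l : C) (y : vfun) :
  vin_Cna a b m n alpha y ->
  vin_Cna a b m n alpha (vscal l y) /\
  vnorm a b m n alpha (vscal l y) <= Cmod l * vnorm a b m n alpha y.
Proof.
  intros Hy; split.
  - intros i Hi; apply in_Cna_scal; auto.
  - unfold vnorm. rewrite <- sumR_scal. apply sumR_le; intros i Hi; apply in_seq0 in Hi.
    apply in_Cna_scal; auto.
Qed.

Lemma vin_sub (n : nat) (y z : vfun) :
  vin_Cna a b m n alpha y -> vin_Cna a b m n alpha z ->
  vin_Cna a b m n alpha (vsub y z) /\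
  vnorm a b m n alpha (vsub y z) <= vnorm a b m n alpha y + vnorm a b m n alpha z.
Proof.
  intros Hy Hz; split.
  - intros i Hi; apply in_Cna_minus; auto.
  - unfold vnorm. rewrite <- sumR_plus. apply sumR_le; intros i Hi; apply in_seq0 in Hi.
    apply in_Cna_minus; auto.
Qed.

Lemma vin_zero (n : nat) :
  vin_Cna a b m n alpha (fun _ _ => RtoC 0) /\ vnorm a b m n alpha (fun _ _ => RtoC 0) = 0.
Proof.
  split.
  - intros i Hi; apply in_Cna_zero.
  - unfold vnorm. rewrite (proj2 (in_Cna_zero n)), sumR_const; ring.
Qed.

Lemma hnorm_le_vnorm (n : nat) (y : vfun) (i : nat) :
  vin_Cna a b m n alpha y -> (i < m)%nat ->
  hnorm a b n alpha (y i) <= vnorm a b m n alpha y.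
Proof.
  intros Hy Hi. apply (sumR_ge_term _ (fun i => hnorm a b n alpha (y i))).
  - intros k Hk; apply in_seq0 in Hk; apply hnorm_ge_0; auto.
  - apply in_seq0; auto.
Qed.

Lemma vnorm_ge_0 (n : nat) (y : vfun) :
  vin_Cna a b m n alpha y -> 0 <= vnorm a b m n alpha y.
Proof.
  intros Hy. apply sumR_ge_0. intros k Hk; apply in_seq0 in Hk; apply hnorm_ge_0; auto.
Qed.

Lemma vnorm_eq_0 (n : nat) (y : vfun) :
  vin_Cna a b m n alpha y -> vnorm a b m n alpha y <= 0 -> veq y (fun _ _ => RtoC 0).
Proof.
  intros Hy H i t Hi Ht. apply Cmod_le_eps_0; intros e He.
  assert (H1 := Cmod_le_hnorm n (y i) t (Hy i Hi) Ht).
  assert (H2 := hnorm_le_vnorm n y i Hy Hi). lra.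
Qed.

Lemma vin_complete (n : nat) (u : nat -> vfun) (c : R) :
  (forall k, vin_Cna a b m n alpha (u k)) ->
  (forall k, vnorm a b m n alpha (vsub (u (S k)) (u k)) <= c * (/ 2) ^ k) ->
  exists x D, vin_Cna a b m n alpha x /\
    forall k, vnorm a b m n alpha (vsub x (u k)) <= D * (/ 2) ^ k.
Proof.
  intros Hu Hc.
  pose (p := fun i => epsilon (inhabits ((fun _ => RtoC 0), 0)) (fun p : (R -> C) * R =>
    in_Cna a b n alpha (fst p) /\
    forall k, hnorm a b n alpha (fun t => fst p t - u k i t)%C <= snd p * (/ 2) ^ k)).
  assert (Hp : forall i, (i < m)%nat -> in_Cna a b n alpha (fst (p i)) /\
    forall k, hnorm a b n alpha (fun t => fst (p i) t - u k i t)%C <= snd (p i) * (/ 2) ^ k).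
  { intros i Hi; unfold p; apply epsilon_spec.
    destruct (in_Cna_complete n (fun k => u k i) c) as (x & D & Hx & HD).
    - intros k; apply Hu; auto.
    - intros k. eapply Rle_trans; [|apply Hc].
      apply (hnorm_le_vnorm n (vsub (u (S k)) (u k))); auto. apply vin_sub; auto.
    - exists (x, D); auto. }
  clearbody p.
  exists (fun i => fst (p i)), (sumR (seq 0 m) (fun i => snd (p i))). split.
  - intros i Hi; apply Hp; auto.
  - intros k. rewrite Rmult_comm, <- sumR_scal. apply sumR_le; intros i Hi; apply in_seq0 in Hi.
    rewrite Rmult_comm. apply Hp; auto.
Qed.

Context (r n : nat).

(** The terms of order below r with arbitrary coefficients. The lower part of L(eps) has this form,
    and so has L(eps) - L(0), where the leading terms cancel. *)
Definition low (M : nat -> mfun) (y : vfun) : vfun := fun i t =>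
  sumC (seq 1 r) (fun j => sumC (seq 0 m) (fun k =>
    Cmult (M (r - j)%nat i k t) (derw a b (y k) (r - j)%nat t))).

(** K is independent of the coefficients and mu enters linearly, so coefficients tending to zero
    give operators tending to zero in norm. *)
Lemma low_bound :
  exists K, 0 <= K /\ forall (M : nat -> mfun) (mu : R) (y : vfun),
    (forall k, (k < r)%nat -> min_Cna a b m n alpha (M k) /\ mnorm a b m n alpha (M k) <= mu) ->
    vin_Cna a b m (n + r) alpha y ->
    vin_Cna a b m n alpha (low M y) /\
    vnorm a b m n alpha (low M y) <= K * mu * vnorm a b m (n + r) alpha y.
Proof.
  destruct (in_Cna_mult n) as (K & HK & Hmul).
  assert (HE : 0 <= emb_const ^ r) by (apply pow_le; assert (H := emb_const_ge_1); lra).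
  (* m components, r orders, the constant of the product estimate, and the embedding constant for
     derivatives of order at most r. *)
  exists (INR m * (INR r * (K * emb_const ^ r))); split.
  { repeat apply Rmult_le_pos; auto using pos_INR. }
  intros M mu y HM Hy.
  set (Y := vnorm a b m (n + r) alpha y).
  assert (Hentry : forall j i k, (1 <= j <= r)%nat -> (i < m)%nat -> (k < m)%nat ->
    in_Cna a b n alpha (fun t => M (r - j)%nat i k t * derw a b (y k) (r - j)%nat t)%C /\
    hnorm a b n alpha (fun t => M (r - j)%nat i k t * derw a b (y k) (r - j)%nat t)%C
      <= K * mu * emb_const ^ r * hnorm a b (n + r) alpha (y k)).
  { intros j i k Hj Hi Hk. destruct (HM (r - j)%nat ltac:(lia)) as [H1 H2].
    destruct (in_Cna_derw_le n r (r - j) (y k) ltac:(lia) (Hy k Hk)) as [H3 H4].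
    destruct (Hmul _ _ (H1 i k Hi Hk) H3) as [H5 H6]. split; auto.
    eapply Rle_trans; [exact H6|]. rewrite !Rmult_assoc. apply Rmult_le_compat_l; auto.
    apply Rmult_le_compat; auto; try (apply hnorm_ge_0; auto).
    eapply Rle_trans; [|exact H2]. unfold mnorm.
    apply Rle_trans with (sumR (seq 0 m) (fun k => hnorm a b n alpha (M (r - j)%nat i k))).
    - apply (sumR_ge_term _ (fun k => hnorm a b n alpha (M (r - j)%nat i k))).
      + intros k' Hk'; apply in_seq0 in Hk'. apply hnorm_ge_0; auto.
      + apply in_seq0; auto.
    - apply (sumR_ge_term _ (fun i => sumR (seq 0 m) (fun k => hnorm a b n alpha (M (r - j)%nat i k)))).
      + intros i' Hi'; apply in_seq0 in Hi'. apply sumR_ge_0.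
        intros k' Hk'; apply in_seq0 in Hk'. apply hnorm_ge_0; auto.
      + apply in_seq0; auto. }
  assert (Hrow : forall j i, (1 <= j <= r)%nat -> (i < m)%nat ->
    in_Cna a b n alpha (fun t => sumC (seq 0 m) (fun k =>
      M (r - j)%nat i k t * derw a b (y k) (r - j)%nat t)%C) /\
    hnorm a b n alpha (fun t => sumC (seq 0 m) (fun k =>
      M (r - j)%nat i k t * derw a b (y k) (r - j)%nat t)%C)
      <= K * mu * emb_const ^ r * Y).
  { intros j i Hj Hi.
    destruct (in_Cna_sumC n (seq 0 m) (fun k t => M (r - j)%nat i k t * derw a b (y k) (r - j)%nat t)%C)
      as [H1 H2]; [intros k Hk; apply in_seq0 in Hk; apply Hentry; auto|].
    split; auto. eapply Rle_trans; [exact H2|]. unfold Y, vnorm. rewrite <- sumR_scal.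
    apply sumR_le; intros k Hk; apply in_seq0 in Hk. apply Hentry; auto. }
  assert (Hcomp : forall i, (i < m)%nat -> in_Cna a b n alpha (low M y i) /\
    hnorm a b n alpha (low M y i) <= INR r * (K * mu * emb_const ^ r * Y)).
  { intros i Hi.
    destruct (in_Cna_sumC n (seq 1 r) (fun j t => sumC (seq 0 m) (fun k =>
        M (r - j)%nat i k t * derw a b (y k) (r - j)%nat t)%C)) as [H1 H2].
    { intros j Hj; apply in_seq in Hj; apply Hrow; auto; lia. }
    split; [exact H1|]. eapply Rle_trans; [exact H2|].
    apply Rle_trans with (sumR (seq 1 r) (fun _ => K * mu * emb_const ^ r * Y));
      [|right; rewrite sumR_const, length_seq; reflexivity].
    apply sumR_le; intros j Hj; apply in_seq in Hj. apply Hrow; auto; lia. }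
  split; [intros i Hi; apply Hcomp; auto|].
  replace (INR m * (INR r * (K * emb_const ^ r)) * mu * Y)
    with (INR (length (seq 0 m)) * (INR r * (K * mu * emb_const ^ r * Y)))
    by (rewrite length_seq; ring).
  rewrite <- sumR_const. apply sumR_le; intros i Hi; apply in_seq0 in Hi. apply Hcomp; auto.
Qed.

Lemma vin_derw (y : vfun) :
  vin_Cna a b m (n + r) alpha y ->
  vin_Cna a b m n alpha (fun i => derw a b (y i) r) /\
  vnorm a b m n alpha (fun i => derw a b (y i) r) <= vnorm a b m (n + r) alpha y.
Proof.
  intros Hy; split.
  - intros i Hi; apply in_Cna_derw; auto.
  - apply sumR_le; intros i Hi; apply in_seq0 in Hi. apply in_Cna_derw; auto.
Qed.

Lemma Lop_plus (A : nat -> R -> mfun) (eps : R) (y z : vfun) :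
  vin_Cna a b m (n + r) alpha y -> vin_Cna a b m (n + r) alpha z ->
  veq (Lop a b m r A eps (vadd y z)) (vadd (Lop a b m r A eps y) (Lop a b m r A eps z)).
Proof.
  intros Hy Hz i t Hi Ht. unfold Lop, vadd.
  rewrite (derw_plus (n + r)) by (auto; lia).
  match goal with |- (_ + _ + ?S = _)%C => replace S with
    (sumC (seq 1 r) (fun j => sumC (seq 0 m) (fun k => Cmult (A (r - j)%nat eps i k t) (derw a b (y k) (r - j)%nat t)))
    + sumC (seq 1 r) (fun j => sumC (seq 0 m) (fun k => Cmult (A (r - j)%nat eps i k t) (derw a b (z k) (r - j)%nat t))))%C end;
    [ring|].
  rewrite <- sumC_plus. apply sumC_ext; intros j Hj. rewrite <- sumC_plus.
  apply sumC_ext; intros k Hk; apply in_seq0 in Hk.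
  rewrite (derw_plus (n + r)) by (auto; lia). ring.
Qed.

Lemma Lop_scal (A : nat -> R -> mfun) (eps : R) (l : C) (y : vfun) :
  vin_Cna a b m (n + r) alpha y ->
  veq (Lop a b m r A eps (vscal l y)) (vscal l (Lop a b m r A eps y)).
Proof.
  intros Hy i t Hi Ht. unfold Lop, vscal.
  rewrite (derw_scal (n + r)) by (auto; lia).
  rewrite Cmult_plus_distr_l, <- sumC_scal. f_equal.
  apply sumC_ext; intros j Hj. rewrite <- sumC_scal.
  apply sumC_ext; intros k Hk; apply in_seq0 in Hk.
  rewrite (derw_scal (n + r)) by (auto; lia). ring.
Qed.

Lemma Lop_zero (A : nat -> R -> mfun) (eps : R) :
  veq (Lop a b m r A eps (fun _ _ => RtoC 0)) (fun _ _ => RtoC 0).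
Proof.
  intros i t Hi Ht.
  replace (fun _ _ => RtoC 0) with (vscal (RtoC 0) (fun _ _ => RtoC 0))
    by (apply functional_extensionality; intros j; apply functional_extensionality; intros s;
        unfold vscal; ring).
  rewrite Lop_scal by (auto; apply vin_zero). unfold vscal; ring.
Qed.

Lemma Lop_sub (A : nat -> R -> mfun) (eps : R) (y z : vfun) :
  vin_Cna a b m (n + r) alpha y -> vin_Cna a b m (n + r) alpha z ->
  veq (Lop a b m r A eps (vsub y z)) (vsub (Lop a b m r A eps y) (Lop a b m r A eps z)).
Proof.
  intros Hy Hz i t Hi Ht. rewrite !vsub_vadd.
  rewrite Lop_plus by (auto; apply vin_scal; auto). unfold vadd at 1 2.
  rewrite Lop_scal by auto. reflexivity.
Qed.

Lemma Lop_eps_sub (A : nat -> R -> mfun) (eps : R) (y : vfun) :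
  vsub (Lop a b m r A eps y) (Lop a b m r A 0 y) = low (fun k => msub (A k eps) (A k 0)) y.
Proof.
  apply functional_extensionality; intros i; apply functional_extensionality; intros t.
  unfold vsub, Lop, low, msub.
  match goal with |- (?d + ?S1 - (?d + ?S2) = ?S3)%C => cut (S1 = S3 + S2)%C end;
    [intros ->; ring|].
  rewrite <- sumC_plus. apply sumC_ext; intros j _. rewrite <- sumC_plus.
  apply sumC_ext; intros k _. ring.
Qed.

Lemma Lop_bound (A : nat -> R -> mfun) (eps : R) :
  (forall k, (k < r)%nat -> min_Cna a b m n alpha (A k eps)) ->
  exists K, 0 <= K /\ forall y, vin_Cna a b m (n + r) alpha y ->
    vin_Cna a b m n alpha (Lop a b m r A eps y) /\
    vnorm a b m n alpha (Lop a b m r A eps y) <= K * vnorm a b m (n + r) alpha y.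
Proof.
  intros HA. destruct low_bound as (K & HK & Hlow).
  set (mu := sumR (seq 0 r) (fun k => mnorm a b m n alpha (A k eps))).
  assert (Hpos : forall k, In k (seq 0 r) -> 0 <= mnorm a b m n alpha (A k eps)).
  { intros k Hk; apply in_seq0 in Hk. apply sumR_ge_0; intros i Hi; apply in_seq0 in Hi.
    apply sumR_ge_0; intros j Hj; apply in_seq0 in Hj. apply hnorm_ge_0, HA; auto. }
  exists (1 + K * mu); split.
  { assert (0 <= K * mu) by (apply Rmult_le_pos; auto; apply sumR_ge_0; auto). lra. }
  intros y Hy. destruct (vin_derw y Hy) as [H1 H2].
  destruct (Hlow (fun k => A k eps) mu y) as [H3 H4]; auto.
  { intros k Hk; split; auto.
    apply (sumR_ge_term _ (fun k => mnorm a b m n alpha (A k eps))); auto. apply in_seq0; auto. }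
  destruct (vin_plus n _ _ H1 H3) as [H5 H6]. split; [exact H5|].
  eapply Rle_trans; [exact H6|]. lra.
Qed.

(** * The boundary-value problem *)

Section Problem.

Context (eps0 : R) (N : (nat -> C) -> R) (A : nat -> R -> mfun) (B : R -> vfun -> nat -> C).

Context (HN : is_norm_on (r * m) N).
Context (Heps0 : 0 < eps0).
Context (HA : forall eps, 0 <= eps < eps0 -> forall k, (k < r)%nat -> min_Cna a b m n alpha (A k eps)).
Context (HB : forall eps, 0 <= eps < eps0 -> cont_lin_op a b m (n + r) alpha (r * m) N (B eps)).
Context (H0 : forall y, vin_Cna a b m (n + r) alpha y ->
  (forall i t, (i < m)%nat -> a <= t <= b -> Lop a b m r A 0 y i t = RtoC 0) ->
  vec_eq (r * m) (B 0 y) (fun _ => RtoC 0) ->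
  forall i t, (i < m)%nat -> a <= t <= b -> y i t = RtoC 0).
Context (HI : forall k, (k < r)%nat -> forall e, 0 < e -> exists d, 0 < d /\
  forall eps, 0 < eps < d -> eps < eps0 -> mnorm a b m n alpha (msub (A k eps) (A k 0)) < e).
Context (HII : forall y, vin_Cna a b m (n + r) alpha y -> forall e, 0 < e -> exists d, 0 < d /\
  forall eps, 0 < eps < d -> eps < eps0 -> N (csub (B eps y) (B 0 y)) < e).
Context (Hex : forall (f : vfun) (c : nat -> C), vin_Cna a b m n alpha f ->
  exists y, is_sol a b m n r alpha A B 0 f c y).

Local Notation PX := (vin_Cna a b m (n + r) alpha).
Local Notation PY := (vin_Cna a b m n alpha).
Local Notation nX := (vnorm a b m (n + r) alpha).
Local Notation nY := (vnorm a b m n alpha).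
Local Notation L := (Lop a b m r A).

(** * Boundary operators and their uniform bound *)

Lemma B_bound (eps : R) : 0 <= eps < eps0 ->
  exists K, 0 <= K /\ forall y, PX y -> N (B eps y) <= K * nX y.
Proof.
  intros He. destruct (HB eps He) as (_ & _ & K & HK). exists (Rabs K); split; [apply Rabs_pos|].
  intros y Hy. eapply Rle_trans; [apply HK; auto|].
  apply Rmult_le_compat_r; [apply vnorm_ge_0; auto|apply Rle_abs].
Qed.

Lemma B_sub (eps : R) (y z : vfun) : 0 <= eps < eps0 -> PX y -> PX z ->
  vec_eq (r * m) (B eps (vsub y z)) (csub (B eps y) (B eps z)).
Proof.
  intros He Hy Hz k Hk. destruct (HB eps He) as (Hp & Hs & _).
  rewrite vsub_vadd. unfold vadd at 1.
  rewrite (Hp y (vscal (RtoC (-1)) z)) by (auto; apply vin_scal; auto).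
  unfold vscal at 1. rewrite (Hs (RtoC (-1)) z) by auto. unfold csub; ring.
Qed.

(** B(eps) acts on functions on R and could look outside [a,b]. Boundedness prevents it: the
    difference of y and z has norm 0. *)
Lemma B_veq (eps : R) (y z : vfun) : 0 <= eps < eps0 -> PX y -> PX z -> veq y z ->
  vec_eq (r * m) (B eps y) (B eps z).
Proof.
  intros He Hy Hz Hyz. destruct (B_bound eps He) as (K & HK & HKB).
  destruct (vin_sub _ _ _ Hy Hz) as [Hw _].
  assert (H1 : N (B eps (vsub y z)) <= 0).
  { eapply Rle_trans; [apply HKB; auto|].
    rewrite (vnorm_ext _ _ (fun _ _ => RtoC 0)), (proj2 (vin_zero _)); [lra|].
    intros i t Hi Ht. unfold vsub. rewrite Hyz by auto. ring. }
  apply (norm_eq_0 _ _ HN) in H1. intros k Hk. specialize (H1 k Hk).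
  rewrite (B_sub eps y z He Hy Hz k Hk) in H1. unfold csub in H1.
  replace (B eps y k) with (B eps y k - B eps z k + B eps z k)%C by ring.
  rewrite H1; ring.
Qed.

Lemma B_zero (eps : R) : 0 <= eps < eps0 ->
  vec_eq (r * m) (B eps (fun _ _ => RtoC 0)) (fun _ => RtoC 0).
Proof.
  intros He. destruct (B_bound eps He) as (K & _ & HK). apply (norm_eq_0 _ _ HN).
  eapply Rle_trans; [apply HK, vin_zero|]. rewrite (proj2 (vin_zero _)); lra.
Qed.

Lemma L_near0_close (e : R) : 0 < e ->
  near0 (fun eps => eps < eps0 /\ forall y, PX y -> nY (vsub (L eps y) (L 0 y)) <= e * nX y).
Proof.
  intros He. destruct low_bound as (K & HK & Hlow).
  assert (Hmu : 0 < e / (K + 1)) by (apply Rdiv_lt_0_compat; lra).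
  assert (H1 : near0 (fun eps => forall k, (k < r)%nat -> eps < eps0 ->
            mnorm a b m n alpha (msub (A k eps) (A k 0)) < e / (K + 1))).
  { apply near0_forall_lt. intros k Hk. destruct (HI k Hk _ Hmu) as (d & Hd & HId).
    exists d; split; auto. }
  refine (near0_imp _ _ _ (near0_and _ _ H1 (near0_lt eps0 Heps0))).
  intros eps Hp [H2 H3]. split; auto. intros y Hy. rewrite Lop_eps_sub.
  destruct (Hlow (fun k => msub (A k eps) (A k 0)) (e / (K + 1)) y) as [_ H4]; auto.
  { intros k Hk. split; [|left; auto]. intros i j Hi Hj.
    apply in_Cna_minus; apply HA; auto; lra. }
  eapply Rle_trans; [exact H4|]. apply Rmult_le_compat_r; [apply vnorm_ge_0; auto|].
  apply Rmult_le_reg_r with (K + 1); [lra|].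
  replace (K * (e / (K + 1)) * (K + 1)) with (K * e) by (field; lra). nra.
Qed.

(** Banach-Steinhaus along a sequence tending to 0. By (II) each y has a bound below a threshold
    depending on y; along a sequence only finitely many indices remain above it, whereas a continuum
    of eps there need not be bounded. *)
Lemma seq_unif_bounded (e : nat -> R) :
  (forall k, 0 < e k < eps0) -> (forall k, e k <= (/ 2) ^ k) ->
  exists K, 0 < K /\ forall k y, PX y -> N (B (e k) y) <= K * nX y.
Proof.
  intros He He2.
  assert (He0 : forall k, 0 <= e k < eps0) by (intros k; specialize (He k); lra).
  destruct (zabreiko PX nX (fun y M => forall k, N (B (e k) y) <= M)) as (K & HK & HZ).
  - apply vin_zero.
  - intros; apply vin_sub; auto.
  - intros; apply vin_scal; auto.
  - intros; apply vnorm_ge_0; auto.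
  - intros; apply vin_complete with c; auto.
  - intros y Hy. destruct (HII y Hy 1 ltac:(lra)) as (d & Hd & Hde).
    destruct (half_pow_small 1 d Hd) as [k0 Hk0].
    destruct (bounded_prefix (fun k => N (B (e k) y)) k0) as [M HM].
    exists (Rmax M (N (B 0 y) + 1)). intros k.
    destruct (Nat.lt_ge_cases k k0) as [Hlt|Hge].
    + eapply Rle_trans; [apply HM; auto|apply Rmax_l].
    + eapply Rle_trans; [|apply Rmax_r].
      eapply Rle_trans; [apply (norm_le_csub _ _ HN _ (B 0 y))|].
      apply Rplus_le_compat_l. left. apply Hde; [|apply He]. split; [apply He|].
      specialize (He2 k).
      assert (Hm : (/ 2) ^ k <= (/ 2) ^ k0).
      { replace k with (k0 + (k - k0))%nat by lia. rewrite pow_add.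
        assert (H1 : (/ 2) ^ (k - k0) <= 1) by (rewrite <- (pow1 (k - k0)); apply pow_incr; lra).
        assert (H2 := half_pow_pos k0).
        apply Rmult_le_compat_l with (r := (/ 2) ^ k0) in H1; lra. }
      lra.
  - intros x M M' HM HQ k. eapply Rle_trans; [apply HQ|auto].
  - intros x y M M' Hx Hy HQx HQy k.
    rewrite (norm_ext _ _ HN _ _ (B_sub _ _ _ (He0 k) Hx Hy)).
    eapply Rle_trans; [apply (norm_csub_le _ _ HN)|]. apply Rplus_le_compat; auto.
  - intros s x M Hx Hs HQ k. destruct (HB _ (He0 k)) as (_ & Hsc & _).
    unfold vscal. rewrite (norm_ext _ _ HN _ _ (Hsc (RtoC s) x Hx)), (norm_scal _ _ HN), Cmod_R, Rabs_pos_eq by lra.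
    apply Rmult_le_compat_l; auto; lra.
  - intros x u M D Hx Hu Hu0 HQ HD k.
    destruct (B_bound _ (He0 k)) as (K & HK & HKB).
    assert (HM : 0 <= M).
    { specialize (HQ 0%nat k). rewrite pow_O, Rmult_1_r in HQ.
      eapply Rle_trans; [apply (norm_ge_0 _ _ HN)|exact HQ]. }
    (* The partial sums of the bounds M / 2^i, starting from B(0 function) = 0; continuity of the
       single operator B(e k) then passes to x. *)
    assert (Hpart : forall j, N (B (e k) (u j)) <= 2 * M - 2 * M * (/ 2) ^ j).
    { induction j as [|j IH].
      - rewrite Hu0. eapply Rle_trans; [apply HKB, vin_zero|]. rewrite (proj2 (vin_zero _)).
        simpl; lra.
      - eapply Rle_trans; [apply (norm_le_csub _ _ HN _ (B (e k) (u j)))|].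
        rewrite <- (norm_ext _ _ HN _ _ (B_sub _ _ _ (He0 k) (Hu (S j)) (Hu j))).
        specialize (HQ j k). simpl. lra. }
    apply le_of_half_pow with (K * D). intros j.
    eapply Rle_trans; [apply (norm_le_csub _ _ HN _ (B (e k) (u j)))|].
    rewrite <- (norm_ext _ _ HN _ _ (B_sub _ _ _ (He0 k) Hx (Hu j))).
    specialize (Hpart j). specialize (HD j).
    assert (H1 := HKB _ (proj1 (vin_sub _ _ _ Hx (Hu j)))).
    apply Rmult_le_compat_l with (r := K) in HD; auto.
    assert (0 <= M * (/ 2) ^ j) by (apply Rmult_le_pos; auto; left; apply half_pow_pos).
    lra.
  - exists K; split; auto. intros k y Hy. apply le_epsilon; intros x Hx.
    assert (Hx' : 0 < x / K) by (apply Rdiv_lt_0_compat; auto).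
    eapply Rle_trans; [apply (HZ y _ Hy Hx')|].
    rewrite Rmult_plus_distr_l. right. field. lra.
Qed.

(** Were there no uniform bound, parameters e k at most 2^-k violating the constants k + 1 would
    form a sequence contradicting [seq_unif_bounded]. *)
Lemma B_near0_bounded :
  exists K, 0 < K /\ near0 (fun eps => forall y, PX y -> N (B eps y) <= K * nX y).
Proof.
  apply NNPP; intros Hno.
  assert (Hseq : forall k : nat, exists e, 0 < e < eps0 /\ e <= (/ 2) ^ k /\
            exists y, PX y /\ (INR k + 1) * nX y < N (B e y)).
  { intros k. apply NNPP; intros Hk. apply Hno.
    exists (INR k + 1). split; [assert (H := pos_INR k); lra|].
    exists (Rmin eps0 ((/ 2) ^ k)). split; [apply Rmin_pos; auto using half_pow_pos|].
    intros e [He1 He2] y Hy. apply Rmin_Rgt_l in He2 as [He2 He3].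
    apply Rnot_lt_le; intros Hlt. apply Hk. exists e; repeat split; try lra.
    exists y; auto. }
  apply choice in Hseq as [e He].
  destruct (seq_unif_bounded e) as (K & HK & HKB); try (intros k; apply (He k)).
  destruct (INR_unbounded K) as [k Hk]. destruct (He k) as (_ & _ & y & Hy & Hlt).
  specialize (HKB k y Hy). assert (HnX := vnorm_ge_0 _ _ Hy).
  assert (K * nX y <= (INR k + 1) * nX y) by (apply Rmult_le_compat_r; lra). lra.
Qed.

(** G sends f to the solution with boundary value 0. Its boundedness is the open mapping theorem on
    the functions with B(0) v = 0, got from Zabreiko's lemma by letting a bound of f be the norm
    bound of a preimage. *)
Lemma L0_right_inverse :
  exists K, 0 < K /\ forall f eta, PY f -> 0 < eta ->
    exists v, PX v /\ veq (L 0 v) f /\ vec_eq (r * m) (B 0 v) (fun _ => RtoC 0) /\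
      nX v <= K * (nY f + eta).
Proof.
  assert (He0 : 0 <= 0 < eps0) by lra.
  destruct (Lop_bound A 0 (HA 0 He0)) as (KL & HKL & HL).
  destruct (B_bound 0 He0) as (KB & HKB & HBb).
  apply (zabreiko PY nY (fun f M => exists v, PX v /\ veq (L 0 v) f /\
    vec_eq (r * m) (B 0 v) (fun _ => RtoC 0) /\ nX v <= M)).
  - apply vin_zero.
  - intros; apply vin_sub; auto.
  - intros; apply vin_scal; auto.
  - intros; apply vnorm_ge_0; auto.
  - intros; apply vin_complete with c; auto.
  - intros f Hf. destruct (Hex f (fun _ => RtoC 0) Hf) as (y & H1 & H2 & H3).
    exists (nX y), y; split; [|split; [|split]]; auto; lra.
  - intros f M M' HM (v & H1 & H2 & H3 & H4). exists v; split; [|split; [|split]]; auto; lra.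
  - intros f g M M' Hf Hg (v & V1 & V2 & V3 & V4) (w & W1 & W2 & W3 & W4).
    exists (vsub v w). destruct (vin_sub _ _ _ V1 W1) as [H1 H2]. split; [|split; [|split]]; auto; try lra.
    + intros i t Hi Ht. rewrite Lop_sub by auto. unfold vsub. rewrite V2, W2 by auto; auto.
    + intros k Hk. rewrite B_sub by auto. unfold csub. rewrite V3, W3 by auto. ring.
  - intros s f M Hf Hs (v & V1 & V2 & V3 & V4).
    exists (vscal (RtoC s) v). destruct (vin_scal _ (RtoC s) _ V1) as [H1 H2].
    split; [|split; [|split]]; auto.
    + intros i t Hi Ht. rewrite Lop_scal by auto. unfold vscal. rewrite V2 by auto; auto.
    + intros k Hk. destruct (HB 0 He0) as (_ & Hsc & _).
      unfold vscal; rewrite Hsc by auto. rewrite V3 by auto. ring.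
    + rewrite Cmod_R, Rabs_pos_eq in H2 by lra.
      apply Rmult_le_compat_l with (r := s) in V4; lra.
  - intros f u M D Hf Hu Hu0 HQ HD.
    apply choice in HQ as [v Hv].
    (* V k adds the first k preimages of the increments, so L(0) V k = u k. The series converges in
       the solution space, and continuity of L(0) and B(0) makes its limit a preimage of f. *)
    pose (V := fix V k := match k with O => (fun _ _ => RtoC 0) : vfun | S k => vadd (V k) (v k) end).
    assert (HVX : forall k, PX (V k)).
    { induction k as [|k IH]; [apply vin_zero|]. apply vin_plus; auto. apply Hv. }
    assert (HVL : forall k, veq (L 0 (V k)) (u k)).
    { induction k as [|k IH]; intros i t Hi Ht.
      - rewrite Hu0. apply (Lop_zero A 0 i t Hi Ht).
      - destruct (Hv k) as (V1 & V2 & _). simpl V. rewrite Lop_plus by auto.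
        unfold vadd. rewrite IH, V2 by auto. unfold vsub; ring. }
    assert (HVB : forall k, vec_eq (r * m) (B 0 (V k)) (fun _ => RtoC 0)).
    { induction k as [|k IH]; intros j Hj.
      - apply (B_zero 0 He0 j Hj).
      - destruct (Hv k) as (V1 & _ & V3 & _). destruct (HB 0 He0) as (Hp & _ & _).
        simpl V. unfold vadd. rewrite Hp, IH, V3 by auto. ring. }
    assert (HM : 0 <= M).
    { destruct (Hv 0%nat) as (V1 & _ & _ & V4). rewrite pow_O, Rmult_1_r in V4.
      eapply Rle_trans; [apply vnorm_ge_0, V1|exact V4]. }
    assert (HVn : forall k, nX (V k) <= 2 * M - 2 * M * (/ 2) ^ k).
    { induction k as [|k IH].
      - simpl V. rewrite (proj2 (vin_zero _)). simpl; lra.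
      - destruct (Hv k) as (V1 & _ & _ & V4). simpl V.
        eapply Rle_trans; [apply vin_plus; auto|]. simpl. lra. }
    destruct (vin_complete (n + r) V M HVX) as (x & E & Hx & HE).
    { intros k. replace (vsub (V (S k)) (V k)) with (v k); [apply Hv|].
      apply functional_extensionality; intros i; apply functional_extensionality; intros t.
      simpl V. unfold vsub, vadd; ring. }
    assert (HxV : forall k, PX (vsub x (V k))) by (intros k; apply vin_sub; auto).
    exists x; split; [|split; [|split]]; auto.
    + assert (Hd : PY (vsub (L 0 x) f)) by (apply vin_sub; auto; apply HL; auto).
      assert (Hz : veq (vsub (L 0 x) f) (fun _ _ => RtoC 0)).
      { apply vnorm_eq_0 with n; auto.
        apply le_of_half_pow with (KL * E + D). intros k.
        destruct (HL _ (HxV k)) as [H1 H2].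
        assert (H3 := proj1 (vin_sub _ _ _ Hf (Hu k))).
        rewrite (vnorm_ext n _ (vsub (L 0 (vsub x (V k))) (vsub f (u k)))).
        - eapply Rle_trans; [apply vin_sub; auto|].
          specialize (HE k). specialize (HD k).
          apply Rmult_le_compat_l with (r := KL) in HE; auto. lra.
        - intros i t Hi Ht. unfold vsub at 1 2 4. rewrite Lop_sub by auto.
          unfold vsub. rewrite HVL by auto. ring. }
      intros i t Hi Ht. specialize (Hz i t Hi Ht). unfold vsub in Hz.
      replace (L 0 x i t) with (L 0 x i t - f i t + f i t)%C by ring. rewrite Hz; ring.
    + apply (norm_eq_0 _ _ HN). apply le_of_half_pow with (KB * E). intros k.
      rewrite (norm_ext _ _ HN _ (B 0 (vsub x (V k)))).
      * specialize (HE k). apply Rmult_le_compat_l with (r := KB) in HE; auto.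
        assert (H1 := HBb _ (HxV k)). lra.
      * intros j Hj. rewrite B_sub by auto. unfold csub. rewrite HVB by auto. ring.
    + apply le_of_half_pow with E. intros k. specialize (HE k). specialize (HVn k).
      replace x with (vadd (vsub x (V k)) (V k)).
      * eapply Rle_trans; [apply vin_plus; auto|].
        assert (0 <= M * (/ 2) ^ k) by (apply Rmult_le_pos; auto; left; apply half_pow_pos). lra.
      * apply functional_extensionality; intros i; apply functional_extensionality; intros t.
        unfold vsub, vadd; ring.
Qed.

(** * Finite combinations and the a priori estimate *)

Definition vcomb (c : nat -> C) (w : nat -> vfun) (l : list nat) : vfun :=
  fun i t => sumC l (fun k => c k * w k i t)%C.

Lemma vcomb_cons (c : nat -> C) (w : nat -> vfun) (k : nat) (l : list nat) :
  vcomb c w (k :: l) = vadd (vscal (c k) (w k)) (vcomb c w l).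
Proof. reflexivity. Qed.

Lemma vin_vcomb (c : nat -> C) (w : nat -> vfun) (l : list nat) :
  (forall k, PX (w k)) ->
  PX (vcomb c w l) /\ nX (vcomb c w l) <= sumR l (fun k => Cmod (c k) * nX (w k)).
Proof.
  intros Hw; induction l as [|k l [IH1 IH2]].
  - destruct (vin_zero (n + r)) as [H1 H2]. split; [exact H1|].
    unfold vcomb; simpl; rewrite H2; lra.
  - rewrite vcomb_cons. destruct (vin_scal _ (c k) _ (Hw k)) as [H1 H2].
    destruct (vin_plus _ _ _ H1 IH1) as [H3 H4]. split; auto. simpl. lra.
Qed.

Lemma B_vcomb (eps : R) (c : nat -> C) (w : nat -> vfun) (l : list nat) :
  0 <= eps < eps0 -> (forall k, PX (w k)) ->
  vec_eq (r * m) (B eps (vcomb c w l)) (fun j => sumC l (fun k => c k * B eps (w k) j)%C).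
Proof.
  intros He Hw; induction l as [|k l IH]; intros j Hj.
  - apply (B_zero eps He j Hj).
  - destruct (HB eps He) as (Hp & Hs & _). rewrite vcomb_cons. unfold vadd.
    rewrite Hp; auto; [|apply vin_scal; auto|apply vin_vcomb; auto].
    unfold vscal. rewrite Hs, IH by auto. reflexivity.
Qed.

Lemma L0_vcomb (c : nat -> C) (w : nat -> vfun) (l : list nat) :
  (forall k, PX (w k)) -> (forall k, veq (L 0 (w k)) (fun _ _ => RtoC 0)) ->
  veq (L 0 (vcomb c w l)) (fun _ _ => RtoC 0).
Proof.
  intros Hw HL; induction l as [|k l IH]; intros i t Hi Ht.
  - apply (Lop_zero A 0 i t Hi Ht).
  - rewrite vcomb_cons, Lop_plus; auto; [|apply vin_scal; auto|apply vin_vcomb; auto].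
    unfold vadd. rewrite Lop_scal, IH by auto. unfold vscal. rewrite HL by auto. ring.
Qed.

Lemma L0_Beps_estimate :
  exists K, 0 < K /\ near0 (fun eps => forall u, PX u -> nX u <= K * (nY (L 0 u) + N (B eps u))).
Proof.
  assert (He0 : 0 <= 0 < eps0) by lra.
  set (d := (r * m)%nat) in *.
  destruct (Lop_bound A 0 (HA 0 He0)) as (KL & HKL & HL).
  destruct L0_right_inverse as (KG & HKG & HG).
  destruct (norm_coords _ _ HN) as (KN & HKN & HNc).
  destruct B_near0_bounded as (KB & HKB & HBev).
  assert (Hw : forall k, exists w, is_sol a b m n r alpha A B 0 (fun _ _ => RtoC 0) (unit_vec k) w)
    by (intros k; apply Hex, vin_zero).
  apply choice in Hw as [w Hw].
  assert (HwX : forall k, PX (w k)) by (intros k; apply Hw).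
  set (SW := sumR (seq 0 d) (fun k => nX (w k))).
  assert (HSW : 0 <= SW) by (apply sumR_ge_0; intros; apply vnorm_ge_0; auto).
  assert (HKd : 0 <= KN * INR d) by (apply Rmult_le_pos; auto using pos_INR).
  (* Chosen so that replacing B(eps) by B(0) on S, the combination of the w k, costs at most half of
     N c, which can be absorbed. *)
  set (delta := / (2 * (KN * INR d + 1))).
  assert (Hdelta : 0 < delta) by (apply Rinv_0_lt_compat; lra).
  assert (Hdelta2 : KN * INR d * delta <= / 2).
  { unfold delta. apply Rmult_le_reg_r with (2 * (KN * INR d + 1)); [lra|].
    rewrite Rmult_assoc, Rinv_l; lra. }
  assert (Hwev : near0 (fun eps => forall k, (k < d)%nat -> eps < eps0 ->
            N (csub (B eps (w k)) (B 0 (w k))) < delta)).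
  { apply near0_forall_lt. intros k Hk. destruct (HII (w k) (HwX k) delta Hdelta) as (x & Hx & H).
    exists x; auto. }
  assert (HKK : 0 <= 2 * KN * SW) by (repeat apply Rmult_le_pos; lra).
  assert (HKK2 : 0 <= 2 * KN * SW * KB) by (apply Rmult_le_pos; lra).
  (* Collects |u| <= |v| + |S|, |S| <= KN SW |c|, |c| <= 2 (|B(eps) u| + KB |v|) and |v| <= KG
     (|L(0) u| + eta). *)
  set (K := (1 + 2 * KN * SW * KB) * KG + 2 * KN * SW).
  assert (HK1 : 0 < (1 + 2 * KN * SW * KB) * KG) by (apply Rmult_lt_0_compat; lra).
  assert (HK : 0 < K) by (unfold K; lra).
  exists K; split; auto.
  refine (near0_imp _ _ _ (near0_and _ _ (near0_and _ _ HBev Hwev) (near0_lt eps0 Heps0))).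
  intros eps Heps [[HBe Hwe] Hlt] u Hu.
  assert (He : 0 <= eps < eps0) by lra.
  apply le_epsilon; intros x Hx.
  (* The slack of the right inverse, multiplied by a constant not exceeding K, adds at most x. *)
  assert (Heta : 0 < x / K) by (apply Rdiv_lt_0_compat; auto).
  destruct (HL u Hu) as [HLu _].
  destruct (HG _ _ HLu Heta) as (v & Hv & HvL & HvB & Hvn).
  set (c := B 0 u). set (S := vcomb c w (seq 0 d)).
  destruct (vin_vcomb c w (seq 0 d) HwX) as [HS HSn]. fold S in HS, HSn.
  destruct (vin_sub _ _ _ Hu Hv) as [Huv _].
  assert (HSB : vec_eq d (B 0 S) c).
  { intros j Hj. unfold S. rewrite (B_vcomb 0 c w (seq 0 d) He0 HwX j Hj).
    rewrite <- (sumC_unit_vec d j c Hj). apply sumC_ext; intros k Hk.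
    destruct (Hw k) as (_ & _ & Hwk). rewrite (Hwk j Hj). reflexivity. }
  (* Uniqueness (0) for u - v - S: L(0) gives L(0) u - L(0) u - 0 and B(0) gives c - 0 - c. *)
  assert (HuS : veq S (vsub u v)).
  { intros i t Hi Ht.
    assert (E : vsub (vsub u v) S i t = RtoC 0).
    { apply H0; auto.
      - apply vin_sub; auto.
      - intros i' t' Hi' Ht'. rewrite Lop_sub by auto. unfold vsub at 1.
        rewrite Lop_sub by auto. unfold vsub. rewrite HvL by auto.
        unfold S; rewrite L0_vcomb; auto; [ring|].
        intros k; destruct (Hw k) as (_ & H1 & _). exact H1.
      - intros j Hj. rewrite B_sub by auto. unfold csub. rewrite B_sub by auto.
        unfold csub. rewrite HvB, HSB by auto. unfold c; ring. }
    unfold vsub in E |- *. replace (S i t) with (u i t - v i t - (u i t - v i t - S i t))%C by ring.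
    rewrite E; ring. }
  assert (Hcoord : forall k, In k (seq 0 d) -> Cmod (c k) <= KN * N c)
    by (intros k Hk; apply in_seq0 in Hk; auto).
  assert (HNc0 := norm_ge_0 _ _ HN c).
  assert (Hdiff : N (csub (B 0 S) (B eps S)) <= / 2 * N c).
  { rewrite (norm_csub_sym _ _ HN).
    rewrite (norm_ext _ _ HN _ (fun j => sumC (seq 0 d) (fun k => c k * csub (B eps (w k)) (B 0 (w k)) j)%C)).
    - eapply Rle_trans; [apply (norm_sumC _ _ HN)|].
      apply Rle_trans with (sumR (seq 0 d) (fun _ => KN * N c * delta)).
      + apply sumR_le; intros k Hk. apply Rmult_le_compat; auto using Cmod_ge_0.
        * apply (norm_ge_0 _ _ HN).
        * apply in_seq0 in Hk. left; apply Hwe; auto.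
      + rewrite sumR_const, length_seq.
        apply Rmult_le_compat_r with (r := N c) in Hdelta2; lra.
    - intros j Hj. unfold csub, S. rewrite !(B_vcomb _ c w (seq 0 d)) by auto.
      rewrite (sumC_ext _ (fun k => c k * (B eps (w k) j - B 0 (w k) j))%C
        (fun k => c k * B eps (w k) j + RtoC (-1) * (c k * B 0 (w k) j))%C) by (intros; ring).
      rewrite sumC_plus, sumC_scal. ring. }
  assert (HBS : N (B eps S) <= N (B eps u) + KB * nX v).
  { rewrite (norm_ext _ _ HN _ (csub (B eps u) (B eps v))).
    - eapply Rle_trans; [apply (norm_csub_le _ _ HN)|]. apply Rplus_le_compat_l; auto.
    - intros j Hj. rewrite <- B_sub by auto. apply B_veq; auto. }
  assert (HNcb : N c <= 2 * (N (B eps u) + KB * nX v)).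
  { assert (H1 := norm_le_csub _ _ HN (B 0 S) (B eps S)).
    rewrite (norm_ext _ _ HN _ _ HSB) in H1. lra. }
  assert (HnS : nX S <= KN * N c * SW).
  { eapply Rle_trans; [exact HSn|]. unfold SW. rewrite <- sumR_scal.
    apply sumR_le; intros k Hk. apply Rmult_le_compat_r; auto. apply vnorm_ge_0; auto. }
  assert (Hnu : nX u <= nX v + nX S).
  { rewrite (vnorm_ext _ u (vadd v S)); [apply vin_plus; auto|].
    intros i t Hi Ht. unfold vadd. rewrite HuS by auto. unfold vsub; ring. }
  assert (HNb := norm_ge_0 _ _ HN (B eps u)). assert (HnY := vnorm_ge_0 _ _ HLu).
  assert (H1 : KN * SW * N c <= KN * SW * (2 * (N (B eps u) + KB * nX v)))
    by (apply Rmult_le_compat_l; auto; apply Rmult_le_pos; auto).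
  assert (H2 : (1 + 2 * KN * SW * KB) * nX v
               <= (1 + 2 * KN * SW * KB) * (KG * (nY (L 0 u) + x / K)))
    by (apply Rmult_le_compat_l; lra).
  assert (H3 : K * (x / K) = x) by (field; lra).
  assert (H4 : 0 <= 2 * KN * SW * nY (L 0 u)) by (apply Rmult_le_pos; auto).
  assert (H5 : 0 <= (1 + 2 * KN * SW * KB) * KG * N (B eps u)) by (apply Rmult_le_pos; lra).
  assert (H6 : 0 <= 2 * KN * SW * (x / K)) by (apply Rmult_le_pos; lra).
  unfold K in H3 at 1. unfold K at 1. lra.
Qed.

Lemma two_sided_estimate :
  exists K1 K2, 0 < K1 /\ 0 < K2 /\ near0 (fun eps => forall u, PX u ->
    K1 * (nY (L eps u) + N (B eps u)) <= nX u /\ nX u <= K2 * (nY (L eps u) + N (B eps u))).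
Proof.
  assert (He0 : 0 <= 0 < eps0) by lra.
  destruct (Lop_bound A 0 (HA 0 He0)) as (KL & HKL & HL).
  destruct B_near0_bounded as (KB & HKB & HBev).
  destruct L0_Beps_estimate as (K & HK & HKev).
  assert (He : 0 < / (2 * K)) by (apply Rinv_0_lt_compat; lra).
  (* Then K e = 1/2, so passing from L(0) to L(eps) costs half of the norm of u and the constant K
     doubles. *)
  set (e := / (2 * K)) in *.
  (* KL + e bounds L(eps) and KB bounds B(eps). *)
  exists (/ (KL + e + KB)), (2 * K).
  split; [apply Rinv_0_lt_compat; lra|]. split; [lra|].
  refine (near0_imp _ _ _ (near0_and _ _ (near0_and _ _ HBev HKev) (L_near0_close e He))).
  intros eps Heps [[HBe HKe] [Hlt HLe]] u Hu.
  specialize (HBe u Hu). specialize (HKe u Hu). specialize (HLe u Hu).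
  destruct (HL u Hu) as [HL0 HL0n].
  destruct (Lop_bound A eps (HA eps ltac:(lra))) as (KL' & _ & HL'). destruct (HL' u Hu) as [HLe' _].
  assert (HnX := vnorm_ge_0 _ _ Hu).
  assert (Hd := proj1 (vin_sub _ _ _ HLe' HL0)).
  assert (H1 : nY (L 0 u) <= nY (L eps u) + e * nX u).
  { eapply Rle_trans; [|apply Rplus_le_compat_l, HLe].
    rewrite (vnorm_ext n (L 0 u) (vsub (L eps u) (vsub (L eps u) (L 0 u)))); [apply vin_sub; auto|].
    intros i t _ _. unfold vsub; ring. }
  assert (H2 : nY (L eps u) <= nY (L 0 u) + e * nX u).
  { eapply Rle_trans; [|apply Rplus_le_compat_l, HLe].
    rewrite (vnorm_ext n (L eps u) (vadd (L 0 u) (vsub (L eps u) (L 0 u)))); [apply vin_plus; auto|].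
    intros i t _ _. unfold vadd, vsub; ring. }
  split.
  - apply Rmult_le_reg_l with (KL + e + KB); [lra|].
    rewrite <- Rmult_assoc, Rinv_r by lra. lra.
  - apply Rmult_le_compat_l with (r := K) in H1; [|lra].
    assert (H3 : K * (e * nX u) = nX u / 2) by (unfold e; field; lra). lra.
Qed.

End Problem.
End Interval.

Theorem theorem1
  (a b : R) (m r n : nat) (alpha eps0 : R)
  (N : (nat -> C) -> R)
  (A : nat -> R -> mfun) (B : R -> vfun -> nat -> C) (eps1 : R) :
  a < b -> (1 <= m)%nat -> (2 <= r)%nat -> 0 < alpha <= 1 -> 0 < eps0 ->
  is_norm_on (r * m) N ->
  (* data *)
  (forall eps, 0 <= eps < eps0 -> forall k, (k < r)%nat -> min_Cna a b m n alpha (A k eps)) ->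
  (forall eps, 0 <= eps < eps0 -> cont_lin_op a b m (n + r) alpha (r * m) N (B eps)) ->
  (* (0) *)
  (forall y, vin_Cna a b m (n + r) alpha y ->
     (forall i t, (i < m)%nat -> a <= t <= b -> Lop a b m r A 0 y i t = RtoC 0) ->
     vec_eq (r * m) (B 0 y) (fun _ => RtoC 0) ->
     forall i t, (i < m)%nat -> a <= t <= b -> y i t = RtoC 0) ->
  (* (I) *)
  (forall k, (k < r)%nat -> forall e, 0 < e -> exists d, 0 < d /\
     forall eps, 0 < eps < d -> eps < eps0 ->
       mnorm a b m n alpha (msub (A k eps) (A k 0)) < e) ->
  (* (II) *)
  (forall y, vin_Cna a b m (n + r) alpha y -> forall e, 0 < e -> exists d, 0 < d /\
     forall eps, 0 < eps < d -> eps < eps0 -> N (csub (B eps y) (B 0 y)) < e) ->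
  (* choice of eps1 *)
  0 < eps1 < eps0 ->
  (forall eps, 0 <= eps < eps1 -> forall (f : vfun) (c : nat -> C),
     vin_Cna a b m n alpha f ->
     (exists y, is_sol a b m n r alpha A B eps f c y) /\
     (forall y z, is_sol a b m n r alpha A B eps f c y -> is_sol a b m n r alpha A B eps f c z ->
        forall i t, (i < m)%nat -> a <= t <= b -> y i t = z i t)) ->
  exists eps2 kap1 kap2, 0 < eps2 < eps1 /\ 0 < kap1 /\ 0 < kap2 /\
    forall (f : R -> vfun) (c : R -> nat -> C) (y : R -> vfun),
      (forall eps, 0 <= eps < eps1 ->
         vin_Cna a b m n alpha (f eps) /\ is_sol a b m n r alpha A B eps (f eps) (c eps) (y eps)) ->
      forall eps, 0 < eps < eps2 ->
        let d := vnorm a b m n alpha (vsub (Lop a b m r A eps (y 0)) (f eps))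
                 + N (csub (B eps (y 0)) (c eps)) in
        kap1 * d <= vnorm a b m (n + r) alpha (vsub (y 0) (y eps)) /\
        vnorm a b m (n + r) alpha (vsub (y 0) (y eps)) <= kap2 * d.
Proof.
  intros Hab _ _ Halpha Heps0 HN HA HB H0 HI HII Heps1 Hsol.
  destruct (two_sided_estimate a b Hab alpha Halpha m r n eps0 N A B HN Heps0 HA HB H0 HI HII)
    as (K1 & K2 & HK1 & HK2 & d & Hd & Hest).
  { intros f c Hf. apply (Hsol 0 ltac:(lra) f c Hf). }
  assert (Hmin : 0 < Rmin d eps1) by (apply Rmin_pos; lra).
  assert (Hmin1 := Rmin_l d eps1). assert (Hmin2 := Rmin_r d eps1).
  (* Halving makes eps2 strictly smaller than eps1. *)
  exists (Rmin d eps1 / 2), K1, K2. split; [lra|]. split; [auto|]. split; [auto|].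
  intros f c y Hy eps Heps.
  destruct (Hy 0 ltac:(lra)) as (_ & Hy0 & _).
  destruct (Hy eps ltac:(lra)) as (_ & Hye & HLe & HBe).
  cbv zeta.
  (* As y(eps) solves its own problem, the two residuals are L(eps) u and B(eps) u for u = y(0) -
     y(eps). *)
  rewrite (vnorm_ext a b alpha Halpha m n _ (Lop a b m r A eps (vsub (y 0) (y eps)))).
  - destruct HN as [HNe HN']. rewrite (HNe _ (B eps (vsub (y 0) (y eps)))).
    + apply Hest; [lra|]. apply vin_sub; auto.
    + intros k Hk. symmetry. rewrite (B_sub a b Hab alpha Halpha m r n eps0 N B HB) by (auto; lra).
      unfold csub. rewrite HBe by auto. reflexivity.
  - intros i t Hi Ht. symmetry. rewrite (Lop_sub a b Hab alpha Halpha m r n) by auto.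
    unfold vsub. rewrite HLe by auto. reflexivity.
Qed.
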